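(* Let $w=\log_2 7$. For any $s\in[n^2,n^w]$, there is a parallel algorithm (called Strassen-W-Adaptive) in the binary-forking model without locks and atomic instructions that multiplies two $n\times n$ matrices using the arithmetic of Strassen's recursive matrix multiplication algorithm, uses $\Theta(s)$ space, and has $O(n^w)$ work and $O((n^w/s)\log^2 n)$ span.
   Context: Binary-forking model: a computation starts with a single thread; any thread may fork a concurrent asynchronous child thread, recursively, and threads are synchronized by join operations; the computation is a series-parallel DAG. No locks and no atomic instructions are used. Work is the total number of instructions; span is the length of the longest path in the DAG; space is the memory allocated (from the heap). Strassen's algorithm multiplies $n\times n$ matrices by splitting each into $2\times2$ blocks, forming 7 recursive half-size block products of linear combinations of input blocks, and combining them linearly into output blocks. *)

(* Defs.v *)
From mathcomp Require Import all_boot all_order all_algebra.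
From mathcomp Require Import reals exp.
Set Implicit Arguments.
Unset Strict Implicit.
Unset Printing Implicit Defensive.
Import Order.TTheory GRing.Theory Num.Theory.

(* Scalars are opaque to programs and no law is assumed, so [car] may for
   instance be the type of formal expressions: two procedures that agree over
   every [arith] evaluate literally the same arithmetic expressions. *)
Record arith := Arith {
  car :> Type;
  azero : car;
  aadd : car -> car -> car;
  asub : car -> car -> car;
  amul : car -> car -> car
}.

Definition ring_arith (K : pzRingType) : arith :=
  @Arith K 0%R +%R (fun x y => (x - y)%R) *%R.

Inductive arith_op := OAdd | OSub | OMul.

Definition apply_op (V : arith) (o : arith_op) : V -> V -> V :=
  match o with OAdd => @aadd V | OSub => @asub V | OMul => @amul V end.

(* This is [2 ^ k], in a form for which the block operations need no cast. *)
Fixpoint pow2 (k : nat) : nat := if k is k'.+1 then pow2 k' + pow2 k' else 1.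

Section Strassen.
Variable V : arith.

Let madd n (A B : 'M[V]_n) : 'M[V]_n := map2_mx (@aadd V) A B.
Let msub n (A B : 'M[V]_n) : 'M[V]_n := map2_mx (@asub V) A B.

Fixpoint strassen_rec (k : nat) :
    'M[V]_(pow2 k) -> 'M[V]_(pow2 k) -> 'M[V]_(pow2 k) :=
  match k return
    'M[V]_(pow2 k) -> 'M[V]_(pow2 k) -> 'M[V]_(pow2 k)
  with
  | 0 => fun A B => map2_mx (@amul V) A B
  | k'.+1 => fun (A B : 'M[V]_(pow2 k' + pow2 k')) =>
    let A11 := ulsubmx A in let A12 := ursubmx A in
    let A21 := dlsubmx A in let A22 := drsubmx A in
    let B11 := ulsubmx B in let B12 := ursubmx B in
    let B21 := dlsubmx B in let B22 := drsubmx B in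
    let M1 := strassen_rec (madd A11 A22) (madd B11 B22) in
    let M2 := strassen_rec (madd A21 A22) B11 in
    let M3 := strassen_rec A11 (msub B12 B22) in
    let M4 := strassen_rec A22 (msub B21 B11) in
    let M5 := strassen_rec (madd A11 A12) B22 in
    let M6 := strassen_rec (msub A21 A11) (madd B11 B12) in
    let M7 := strassen_rec (msub A12 A22) (madd B21 B22) in
    block_mx (madd (msub (madd M1 M4) M5) M7) (madd M3 M5)
             (madd M2 M4) (madd (madd (msub M1 M2) M3) M6)
  end.

(* Top-left corner of [A], padded with zeros where [A] has no entry. *)
Definition resize_mx n m (A : 'M[V]_n) : 'M[V]_m :=
  \matrix_(i < m, j < m)
    match insub (val i) : option 'I_n, insub (val j) : option 'I_n with
    | Some i', Some j' => A i' j'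
    | _, _ => azero V
    end.

(* [up_log 2 n] is the least [k] with [n <= 2 ^ k]: there is no padding when
   [n] is a power of two. *)
Definition strassen n (A B : 'M[V]_n) : 'M[V]_n :=
  resize_mx n (strassen_rec (resize_mx (pow2 (up_log 2 n)) A)
                            (resize_mx (pow2 (up_log 2 n)) B)).

End Strassen.

(* [inl i] are the blocks that exist before the computation, [inr p] the block
   allocated on the heap at path [p] (see [unfolds]). *)
Definition block : Type := (nat + seq bool)%type.
Definition loc : Type := (block * nat)%type.

Definition inA : block := inl 0.
Definition inB : block := inl 1.
Definition outC : block := inl 2.
Definition null : block := inl 3.

(* [None]: not allocated.  A cell holding [None] is not initialised. *)
Definition heap (V : Type) := block -> option (seq (option V)).

Definition read V (h : heap V) (l : loc) : option V :=
  if h l.1 is Some t then nth None t l.2 else None.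

Definition upd_block V (h : heap V) (b : block) x : heap V :=
  fun b' => if b' == b then x else h b'.

Definition write V (h : heap V) (l : loc) (v : V) : option (heap V) :=
  if h l.1 is Some t then
    if l.2 < size t then Some (upd_block h l.1 (Some (set_nth None t l.2 (Some v))))
    else None
  else None.

(* Executed instructions; [Tick] is an instruction that touches only the
   registers of its thread.  There is no lock, atomic or read-modify-write
   instruction. *)
Inductive action :=
| Tick
| SetZero of loc
| Copy of loc & loc
| Compute of arith_op & loc & loc & loc
| Malloc of block & nat
| Free of block.

(* [None]: memory fault (unallocated, out of bounds or uninitialised). *)
Definition step (V : arith) (a : action) (h : heap V) : option (heap V) :=
  match a with
  | Tick => Some h
  | SetZero d => write h d (azero V)
  | Copy d x => if read h x is Some v then write h d v else None
  | Compute o d x y =>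
      if (read h x, read h y) is (Some u, Some v)
      then write h d (apply_op o u v) else None
  | Malloc b n =>
      if h b is None then Some (upd_block h b (Some (nseq n None))) else None
  | Free b => if h b is Some _ then Some (upd_block h b None) else None
  end.

Fixpoint run (V : arith) (sigma : seq action) (h : heap V) : option (heap V) :=
  if sigma is a :: sigma' then obind (run sigma') (step a h) else Some h.

Definition reads_action (a : action) : pred loc :=
  match a with
  | Copy _ x => pred1 x
  | Compute _ _ x y => pred2 x y
  | _ => pred0
  end.

Definition writes_action (a : action) : pred loc :=
  match a with
  | Tick => pred0
  | SetZero d | Copy d _ | Compute _ d _ _ => pred1 d
  | Malloc b _ | Free b => [pred l : loc | l.1 == b]
  end.

(* [Scope b n G] allocates block [b] of [n] cells, runs [G] and frees [b]. *)
Inductive dag :=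
| Leaf of action
| Ser of dag & dag
| Par of dag & dag
| Scope of block & nat & dag.

Fixpoint dag_work (G : dag) : nat :=
  match G with
  | Leaf _ => 1
  | Ser G1 G2 | Par G1 G2 => dag_work G1 + dag_work G2
  | Scope _ _ G1 => (dag_work G1).+2
  end.

Fixpoint dag_span (G : dag) : nat :=
  match G with
  | Leaf _ => 1
  | Ser G1 G2 => dag_span G1 + dag_span G2
  | Par G1 G2 => maxn (dag_span G1) (dag_span G2)
  | Scope _ _ G1 => (dag_span G1).+2
  end.

(* Largest number of heap cells simultaneously allocated, over all schedules:
   two parallel computations may reach their peaks together, whereas scoping
   makes the first of two serial ones return all its memory.  The caller's
   blocks [inA], [inB] and [outC] are not counted. *)
Fixpoint dag_space (G : dag) : nat :=
  match G with
  | Leaf _ => 0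
  | Ser G1 G2 => maxn (dag_space G1) (dag_space G2)
  | Par G1 G2 => dag_space G1 + dag_space G2
  | Scope _ n G1 => n + dag_space G1
  end.

Fixpoint reads (G : dag) : pred loc :=
  match G with
  | Leaf a => reads_action a
  | Ser G1 G2 | Par G1 G2 => predU (reads G1) (reads G2)
  | Scope _ _ G1 => reads G1
  end.

Fixpoint writes (G : dag) : pred loc :=
  match G with
  | Leaf a => writes_action a
  | Ser G1 G2 | Par G1 G2 => predU (writes G1) (writes G2)
  | Scope b _ G1 => predU [pred l : loc | l.1 == b] (writes G1)
  end.

(* Concurrent reads are allowed; a write is never concurrent with another
   access to the same cell, so that no access needs to be atomic. *)
Fixpoint race_free (G : dag) : Prop :=
  match G with
  | Leaf _ => True
  | Ser G1 G2 => race_free G1 /\ race_free G2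
  | Par G1 G2 => [/\ race_free G1, race_free G2 &
      forall l, ~~ (writes G1 l && (reads G2 l || writes G2 l)) /\
                ~~ (writes G2 l && reads G1 l)]
  | Scope _ _ G1 => race_free G1
  end.

Inductive interleave (T : Type) : seq T -> seq T -> seq T -> Prop :=
| interleave_nil : interleave [::] [::] [::]
| interleave_l x s t u : interleave s t u -> interleave (x :: s) t (x :: u)
| interleave_r y s t u : interleave s t u -> interleave s (y :: t) (y :: u).

(* The asynchronous executions of a DAG, i.e. its topological orderings. *)
Inductive schedule : dag -> seq action -> Prop :=
| sched_leaf a : schedule (Leaf a) [:: a]
| sched_ser G1 G2 s1 s2 :
    schedule G1 s1 -> schedule G2 s2 -> schedule (Ser G1 G2) (s1 ++ s2)
| sched_par G1 G2 s1 s2 s :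
    schedule G1 s1 -> schedule G2 s2 -> interleave s1 s2 s ->
    schedule (Par G1 G2) s
| sched_scope b n G s :
    schedule G s -> schedule (Scope b n G) (Malloc b n :: rcons s (Free b)).

(* A program is a finite list of mutually recursive procedures.  Registers,
   which are private to a thread, hold integers or block names, never scalars;
   scalars live in memory only.  As a program contains finitely many
   expressions, charging one unit per instruction charges each integer
   operation up to a constant factor. *)
Inductive expr :=
| EVar of nat
| ECst of nat
| EAdd of expr & expr
| ESub of expr & expr
| EMul of expr & expr
| EDiv of expr & expr.

Fixpoint eval (rho : nat -> nat) (e : expr) : nat :=
  match e with
  | EVar x => rho x
  | ECst c => c
  | EAdd e1 e2 => eval rho e1 + eval rho e2
  | ESub e1 e2 => eval rho e1 - eval rho e2
  | EMul e1 e2 => eval rho e1 * eval rho e2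
  | EDiv e1 e2 => eval rho e1 %/ eval rho e2
  end.

(* A memory operand [(x, e)] is cell [e] of the block held by [x]. *)
Definition operand : Type := (nat * expr)%type.

Inductive cmd :=
| CSkip
| CSet of nat & expr
| CZero of operand
| CCopy of operand & operand
| CCompute of arith_op & operand & operand & operand
| CSeq of cmd & cmd
| CIfLe of expr & expr & cmd & cmd
| CCall of nat & seq nat & seq expr
| CFork of cmd & cmd
| CAlloc of nat & expr & cmd.

Definition program := seq cmd.

Definition upd T (f : nat -> T) (x : nat) (v : T) : nat -> T :=
  fun y => if y == x then v else f y.

Definition addr (beta : nat -> block) (rho : nat -> nat) (o : operand) : loc :=
  (beta o.1, eval rho o.2).

(* [unfolds P p beta rho c rho' G]: the thread of path [p] with block registers
   [beta] and integer registers [rho] executes [c], which generates the DAG [G]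
   and leaves the integer registers [rho'].  Control never depends on scalars,
   hence neither does [G].

   The path records the forks and the open allocation scopes leading to the
   current point, so that blocks alive at the same time have distinct names.
   The two branches of a fork start with copies of the registers; their
   parent resumes after the join with its own registers. *)
Inductive unfolds (P : program) : seq bool -> (nat -> block) -> (nat -> nat) ->
    cmd -> (nat -> nat) -> dag -> Prop :=
| unf_skip p beta rho :
    unfolds P p beta rho CSkip rho (Leaf Tick)
| unf_set p beta rho x e :
    unfolds P p beta rho (CSet x e) (upd rho x (eval rho e)) (Leaf Tick)
| unf_zero p beta rho d :
    unfolds P p beta rho (CZero d) rho (Leaf (SetZero (addr beta rho d)))
| unf_copy p beta rho d x :
    unfolds P p beta rho (CCopy d x) rho
      (Leaf (Copy (addr beta rho d) (addr beta rho x)))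
| unf_compute p beta rho o d x y :
    unfolds P p beta rho (CCompute o d x y) rho
      (Leaf (Compute o (addr beta rho d) (addr beta rho x) (addr beta rho y)))
| unf_seq p beta rho c1 c2 rho1 rho2 G1 G2 :
    unfolds P p beta rho c1 rho1 G1 ->
    unfolds P p beta rho1 c2 rho2 G2 ->
    unfolds P p beta rho (CSeq c1 c2) rho2 (Ser G1 G2)
| unf_if p beta rho e1 e2 c1 c2 rho' G :
    unfolds P p beta rho (if eval rho e1 <= eval rho e2 then c1 else c2)
      rho' G ->
    unfolds P p beta rho (CIfLe e1 e2 c1 c2) rho' (Ser (Leaf Tick) G)
| unf_call p beta rho f xs es rho' G :
    unfolds P p (nth null (map beta xs)) (nth 0 (map (eval rho) es))
      (nth CSkip P f) rho' G ->
    unfolds P p beta rho (CCall f xs es) rho (Ser (Leaf Tick) G)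
| unf_fork p beta rho c1 c2 rho1 rho2 G1 G2 :
    unfolds P (true :: p) beta rho c1 rho1 G1 ->
    unfolds P (false :: p) beta rho c2 rho2 G2 ->
    unfolds P p beta rho (CFork c1 c2) rho
      (Ser (Leaf Tick) (Ser (Par G1 G2) (Leaf Tick)))
| unf_alloc p beta rho x e c rho' G :
    unfolds P (true :: p) (upd beta x (inr p)) rho c rho' G ->
    unfolds P p beta rho (CAlloc x e c) rho' (Scope (inr p) (eval rho e) G).

(* Procedure 0 starts with the matrix blocks in its first three block registers
   and [args] in its first integer registers. *)
Definition computation (P : program) (args : seq nat) (G : dag) : Prop :=
  exists rho', unfolds P [::] (nth null [:: inA; inB; outC]) (nth 0 args)
                 (nth CSkip P 0) rho' G.

(* Row-major storage. *)
Definition stores (V : Type) (h : heap V) (b : block) n (A : 'M[V]_n) : Prop :=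
  exists t, [/\ h b = Some t, size t = n * n &
    forall i j : 'I_n, nth None t (i * n + j) = Some (A i j)].

Definition initial (V : Type) n (A B : 'M[V]_n) (h : heap V) : Prop :=
  [/\ stores h inA A, stores h inB B,
      (exists2 t, h outC = Some t & size t = n * n) &
      forall b, b \notin [:: inA; inB; outC] -> h b = None].

(* Every schedule runs without fault and ends with [C] in the output block. *)
Definition computes (V : arith) n (G : dag) (A B C : 'M[V]_n) : Prop :=
  forall h : heap V, initial A B h ->
  forall sigma, schedule G sigma ->
  exists2 h', run sigma h = Some h' & stores h' outC C.

Definition log2 (R : realType) (x : R) : R := (ln x / ln 2)%R.

Definition omega (R : realType) : R := log2 7%R.

(* Main.v *)
(* A level of the recursion on blocks of dimension [2 * h] allocates one block of
   [21 * h ^ 2] cells for the operands and results of its seven products, fills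
   in the operands, recurses, and combines the results.  Once [7 ^ k] is at most
   the budget [s], for dimension [2 ^ k], the seven calls are forked: the space
   recurrence [7 S(k) + O(4 ^ k)] gives [O(7 ^ k)], which is [O(s)], and the span
   is [O(k ^ 2)].  Above that size they run one after the other, so that only a
   geometric sum [O(n ^ 2)] of space is added, and about [n ^ omega / s] forked
   computations are performed in sequence.
   Every procedure confines all its accesses to its part of the caller's block
   and to the blocks allocated at or below its path, so concurrent branches touch
   disjoint cells.  Actions with disjoint footprints commute, hence every
   schedule has the effect of the sequential one, and correctness need only be
   proved for the latter. *)
Require Import Defs.
From mathcomp Require Import all_boot all_order all_algebra.
From mathcomp Require Import boolp reals exp.
From mathcomp Require Import zify ring lra.
Set Implicit Arguments.
Unset Strict Implicit.
Unset Printing Implicit Defensive.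
Import Order.TTheory GRing.Theory Num.Theory.

(** * Schedules of a race-free DAG *)

(** [unfolds] and [schedule] are relations, awkward for counting. Each procedure is therefore
    matched once with a function that builds its DAG ([loop_dag], [rec_dag], [main_dag]); costs,
    footprints and race freedom are then inductions on the depth [k].

    The recurrences are solved by potentials: since [4 < 7], adding a multiple of [4 ^ k] to the
    bounded quantity absorbs the cost of a level. The span bound is multiplied by [s], which keeps
    it in the naturals.

    The square of the logarithm arises because only binary forks exist: the entrywise loops of a
    level are halving trees of depth [2 * k], and [k] such levels lie on a path.

    An arbitrary [n] is padded to the next power of two, which costs a factor at most 7 in [7 ^ k]
    and 4 in area; the area is absorbed because [n ^ 2 <= s].

    Correctness is a frame argument: every assertion used depends only on the extents and on the
    cells owned by one iteration or one call, so it survives the other ones. *)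

Definition extent V (h : heap V) (b : block) : option nat := omap size (h b).

Definition valid V (h : heap V) (l : loc) : bool :=
  if extent h l.1 is Some n then l.2 < n else false.

Lemma read_upd_other V (h : heap V) b x l :
  l.1 != b -> read (upd_block h b x) l = read h l.
Proof. by rewrite /read /upd_block => /negbTE ->. Qed.

Lemma write_valid V (h : heap V) l v :
  valid h l -> exists2 h', write h l v = Some h' &
    (forall l', read h' l' = if l' == l then Some v else read h l').
Proof.
rewrite /valid /extent /write; case E: (h l.1) => [t|] //= lt; rewrite lt.
eexists; first by [].
move=> [b i]; case: l E lt => c j /= E lt; rewrite /read /upd_block /= xpair_eqE.
by case: eqP => [->|] //=; rewrite nth_set_nth /= E; case: eqP.
Qed.

Lemma write_invalid V (h : heap V) l v : ~~ valid h l -> write h l v = None.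
Proof. by rewrite /valid /extent /write; case: (h l.1) => [t|] //= /negbTE ->. Qed.

Lemma write_extent V (h h' : heap V) l v :
  write h l v = Some h' -> extent h' = extent h.
Proof.
rewrite /write; case E: (h l.1) => [t|] //; case: ifP => // lt [<-].
apply/funext=> b; rewrite /extent /upd_block; case: eqP => [->|] //=.
by rewrite E /= size_set_nth (maxn_idPr lt).
Qed.

Lemma write_read V (h h' : heap V) l v : write h l v = Some h' ->
  forall l', read h' l' = if l' == l then Some v else read h l'.
Proof.
move=> hw; have vl : valid h l.
  by apply: contraT => /(write_invalid v); rewrite hw.
by have [h1 + hr] := write_valid v vl; rewrite hw => -[->].
Qed.

(** Extents are needed besides reads because [read] returns [None] both for an uninitialised cell
    and for a cell that does not exist. *)
Lemma heap_eq V (h h' : heap V) :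
  extent h = extent h' -> read h =1 read h' -> h = h'.
Proof.
move=> hs hr; apply/funext => b; have := congr1 (fun f => f b) hs.
rewrite /extent; case E: (h b) => [t|]; case E': (h' b) => [t'|] //= [es].
congr Some; apply: (@eq_from_nth _ None) => // i _.
by have := hr (b, i); rewrite /read /= E E'.
Qed.

Definition dst (a : action) : loc :=
  match a with
  | SetZero d | Copy d _ | Compute _ d _ _ => d
  | Malloc b _ | Free b => (b, 0)
  | Tick => (null, 0)
  end.

Definition is_write (a : action) : bool :=
  match a with SetZero _ | Copy _ _ | Compute _ _ _ _ => true | _ => false end.

Definition value (V : arith) (a : action) (h : heap V) : option V :=
  match a with
  | SetZero _ => Some (azero V)
  | Copy _ x => read h x
  | Compute o _ x y =>
      if (read h x, read h y) is (Some u, Some v) then Some (apply_op o u v)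
      else None
  | _ => None
  end.

Lemma step_write (V : arith) a (h : heap V) :
  is_write a -> step a h = obind (write h (dst a)) (value a h).
Proof.
by case: a => [|d|d x|o d x y|b n|b] //= _; case: (read h x) => // u; case: (read h y).
Qed.

Lemma writes_is_write a : is_write a -> writes_action a =1 pred1 (dst a).
Proof. by case: a. Qed.

Lemma value_eq (V : arith) a (h h' : heap V) :
  (forall l, reads_action a l -> read h l = read h' l) -> value a h = value a h'.
Proof.
case: a => [|d|d x|o d x y|b n|b] //= e; first by rewrite e //=.
have -> : read h x = read h' x by apply: e; rewrite eqxx.
case: (read h' x) => // u.
have -> // : read h y = read h' y by apply: e; rewrite eqxx orbT.
Qed.

Definition independent (a b : action) : Prop := forall l,
  ~~ (writes_action a l && (reads_action b l || writes_action b l)) /\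
  ~~ (writes_action b l && reads_action a l).

Lemma independent_sym a b : independent a b -> independent b a.
Proof.
move=> i l; have [] := i l.
by case: (writes_action a l); case: (reads_action b l);
  case: (writes_action b l); case: (reads_action a l).
Qed.

Lemma step_frame (V : arith) a (h h' : heap V) l :
  step a h = Some h' -> ~~ writes_action a l -> read h' l = read h l.
Proof.
have [wa|nwa] := boolP (is_write a).
  rewrite step_write // (writes_is_write wa) /=.
  by case: (value a h) => //= v hw /negbTE ne; rewrite (write_read hw) ne.
case: a nwa => [|d|d x|o d x y|b n|b] //= _; first by case=> ->.
  by case: (h b) => // -[<-] ne; rewrite read_upd_other.
by case: (h b) => // t [<-] ne; rewrite read_upd_other.
Qed.


Lemma is_write_extent (V : arith) a (h h' : heap V) :
  is_write a -> step a h = Some h' -> extent h' = extent h.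
Proof.
by move=> wa; rewrite step_write //; case: (value a h) => //= v hw; apply: write_extent hw.
Qed.

Lemma write_upd V (h : heap V) b x d v : d.1 != b ->
  write (upd_block h b x) d v = omap (fun h' => upd_block h' b x) (write h d v).
Proof.
move=> ne; rewrite /write {1}/upd_block (negbTE ne).
case: (h d.1) => [t|] //; case: ifP => //= _; congr Some; apply/funext => c.
by rewrite /upd_block; have [->|//] := eqVneq c d.1; rewrite (negbTE ne).
Qed.

Lemma step_upd (V : arith) a (h : heap V) b x : is_write a ->
  (forall i, ~~ reads_action a (b, i)) -> (dst a).1 != b ->
  step a (upd_block h b x) = omap (fun h' => upd_block h' b x) (step a h).
Proof.
move=> wa nr ne; rewrite !step_write //.
rewrite (@value_eq _ a (upd_block h b x) h) => [|l rl].
  by case: (value a h) => //= v; rewrite write_upd.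
by rewrite read_upd_other //; apply/eqP => e; have := nr l.2; rewrite -e -surjective_pairing rl.
Qed.

(** The effect of an allocation or release on the entry of its own block. Commutation of two such
    actions then reduces to updates of distinct entries. *)
Definition realloc (a : action) V (o : option (seq (option V))) :
    option (option (seq (option V))) :=
  match a with
  | Malloc _ n => if o is None then Some (Some (nseq n None)) else None
  | Free _ => if o is Some _ then Some None else None
  | _ => None
  end.

Definition is_block_op (a : action) : bool :=
  if a is (Malloc _ _ | Free _) then true else false.

Lemma step_block_op (V : arith) a (h : heap V) : is_block_op a ->
  step a h = omap (upd_block h (dst a).1) (realloc a (h (dst a).1)).
Proof. by case: a => //= b; case: (h b). Qed.

Lemma upd_block_comm V (h : heap V) b x c y : b != c ->
  upd_block (upd_block h b x) c y = upd_block (upd_block h c y) b x.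
Proof.
move=> ne; apply/funext => d; rewrite /upd_block.
by have [->|//] := eqVneq d c; rewrite eq_sym (negbTE ne).
Qed.

Lemma writes_block_op a l : is_block_op a -> writes_action a l = (l.1 == (dst a).1).
Proof. by case: a. Qed.

Lemma action_kind a : [\/ a = Tick, is_write a | is_block_op a].
Proof. by case: a; (try by constructor 1); (try by constructor 2); constructor 3. Qed.

(** The equation also covers faults. The other write changes neither the validity of the destination
    nor the operands, so an action that faults in one order faults in the other. If both succeed,
    their destinations differ and the two final heaps have the same extents and reads. *)
Lemma step_comm_write (V : arith) a b (h : heap V) :
  is_write a -> is_write b -> independent a b ->
  obind (step a) (step b h) = obind (step b) (step a h).
Proof.
move=> wa wb ind.
have nab : dst a != dst b.
  have [+ _] := ind (dst a); rewrite !writes_is_write //= eqxx /= => /norP[_ /eqP nd].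
  by apply/eqP => e; apply: nd.
have vab c d (h' : heap V) : is_write c -> is_write d -> independent c d ->
    step d h = Some h' -> value c h' = value c h.
  move=> wc wd icd hs; apply: value_eq => l rl; apply: (step_frame hs).
  by apply/negP => wl; have [_] := icd l; rewrite wl rl.
have inv : forall c (h' : heap V), is_write c -> step c h = Some h' -> valid h' =1 valid h.
  move=> c h' wc; rewrite step_write //; case: (value c h) => //= v hw l.
  by rewrite /valid (write_extent hw).
have [va|na] := boolP (valid h (dst a)); last first.
  have Ea (h' : heap V) : valid h' (dst a) = false -> step a h' = None.
    move=> /negbT n; rewrite step_write //; case: (value a h') => //= v.
    exact: write_invalid.
  rewrite (Ea h) /=; last exact: negbTE.
  by case E: (step b h) => [h'|] //=; apply: Ea; rewrite (inv _ _ wb E); apply: negbTE.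
have [vb|nb] := boolP (valid h (dst b)); last first.
  have Eb (h' : heap V) : valid h' (dst b) = false -> step b h' = None.
    move=> /negbT n; rewrite step_write //; case: (value b h') => //= v.
    exact: write_invalid.
  rewrite (Eb h) /=; last exact: negbTE.
  by case E: (step a h) => [h'|] //=; rewrite Eb // (inv _ _ wa E); apply: negbTE.
case Ea: (value a h) => [x|]; last first.
  rewrite (step_write h wa) Ea /=; case E: (step b h) => [h'|] //=.
  by rewrite step_write // (vab a b h') ?Ea.
case Eb: (value b h) => [y|]; last first.
  rewrite (step_write h wb) Eb /=; case E: (step a h) => [h'|] //=.
  rewrite step_write // (vab b a h') ?Eb //; exact: independent_sym.
have [ha Ha Ra] := write_valid x va; have [hb Hb Rb] := write_valid y vb.
have Sa : step a h = Some ha by rewrite step_write // Ea.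
have Sb : step b h = Some hb by rewrite step_write // Eb.
rewrite Sa Sb /= !step_write // (vab a b hb) // (vab b a ha) //; last exact: independent_sym.
rewrite Ea Eb /=.
have vab' : valid hb (dst a) by rewrite (inv _ _ wb Sb).
have vba' : valid ha (dst b) by rewrite (inv _ _ wa Sa).
have [h1 H1 R1] := write_valid x vab'; have [h2 H2 R2] := write_valid y vba'.
rewrite H1 H2; congr Some; apply: heap_eq.
  by rewrite (write_extent H1) (write_extent H2) (write_extent Ha) (write_extent Hb).
move=> l; rewrite R1 R2 Ra Rb; have [->|//] := eqVneq l (dst a).
by rewrite (negbTE nab).
Qed.

(** A block operation counts as writing every cell of its block, so independence keeps the operands
    and the destination of [a] out of that block. *)
Lemma step_comm_mixed (V : arith) a b (h : heap V) :
  is_write a -> is_block_op b -> independent a b ->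
  obind (step a) (step b h) = obind (step b) (step a h).
Proof.
move=> wa ob ind; set c := (dst b).1.
have ne : (dst a).1 != c.
  have [+ _] := ind (dst a); rewrite writes_is_write //= eqxx /=.
  by rewrite writes_block_op // => /norP[_].
have nr i : ~~ reads_action a (c, i).
  by have [_] := ind (c, i); rewrite writes_block_op //= eqxx.
rewrite (step_block_op h ob) -/c; case E: (realloc b (h c)) => [x|] /=; last first.
  case Es: (step a h) => [h'|] //=; rewrite (step_block_op h' ob) -/c.
  suff -> : h' c = h c by rewrite E.
  move: Es; rewrite step_write //; case: (value a h) => //= v; rewrite /write.
  case: (h (dst a).1) => // t; case: ifP => // _ [<-].
  by rewrite /upd_block eq_sym (negbTE ne).
rewrite step_upd //; case Es: (step a h) => [h'|] //=; rewrite (step_block_op h' ob) -/c.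
suff -> : h' c = h c by rewrite E.
move: Es; rewrite step_write //; case: (value a h) => //= v; rewrite /write.
case: (h (dst a).1) => // t; case: ifP => // _ [<-].
by rewrite /upd_block eq_sym (negbTE ne).
Qed.

Lemma step_comm (V : arith) a b (h : heap V) : independent a b ->
  obind (step a) (step b h) = obind (step b) (step a h).
Proof.
have tick c (h' : heap V) : obind (step c) (step Tick h') = obind (step Tick) (step c h').
  by rewrite /=; case: (step c h').
move=> ind; have [-> | wa | oa] := action_kind a; first by rewrite tick.
  have [-> | wb | ob] := action_kind b; first by rewrite tick.
    exact: step_comm_write.
  exact: step_comm_mixed.
have [-> | wb | ob] := action_kind b; first by rewrite tick.
  by rewrite (@step_comm_mixed _ b a) //; apply: independent_sym.
have ne : (dst a).1 != (dst b).1.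
  have [+ _] := ind (dst a); rewrite !writes_block_op // eqxx /=.
  by case/norP.
rewrite !step_block_op //.
case Ea: (realloc a (h (dst a).1)) => [x|]; case Eb: (realloc b (h (dst b).1)) => [y|] //=.
- rewrite !step_block_op // /upd_block (negbTE ne) eq_sym (negbTE ne) Ea Eb /=.
  by rewrite -!/(upd_block _ _ _) upd_block_comm // eq_sym.
- by rewrite step_block_op // /upd_block eq_sym (negbTE ne) Eb.
- by rewrite step_block_op // /upd_block (negbTE ne) Ea.
Qed.

Lemma run_cat (V : arith) s1 s2 (h : heap V) :
  run (s1 ++ s2) h = obind (run s2) (run s1 h).
Proof. by elim: s1 h => //= a s1 IH h; case: (step a h). Qed.

Lemma run_move (V : arith) a s (h : heap V) :
  (forall b, List.In b s -> independent b a) ->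
  obind (run s) (step a h) = obind (step a) (run s h).
Proof.
elim: s h => [|b s IH] h ind /=; first by case: (step a h).
have -> : obind (fun h' => obind (run s) (step b h')) (step a h)
    = obind (run s) (obind (step b) (step a h)) by case: (step a h).
rewrite step_comm; last by apply: ind; left.
by case: (step b h) => //= h'; apply: IH => c ci; apply: ind; right.
Qed.

(** Whenever the schedule starts with an action of the right branch, [run_move] delays it past all
    that remains of the left branch. *)
Lemma run_interleave (V : arith) s1 s2 s (h : heap V) : interleave s1 s2 s ->
  (forall a b, List.In a s1 -> List.In b s2 -> independent a b) ->
  run s h = run (s1 ++ s2) h.
Proof.
move=> il; elim: il h => {s1 s2 s} [|a s t u _ IH|b s t u _ IH] h ind //=.
  by case: (step a h) => //= h'; apply: IH => x y xi yi; apply: ind; [right|].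
rewrite run_cat /=.
have -> : obind (run u) (step b h) = obind (run t) (obind (run s) (step b h)).
  case: (step b h) => //= h'; rewrite IH ?run_cat // => x y xi yi.
  by apply: ind; [|right].
rewrite run_move; last by move=> x xi; apply: ind => //; left.
by case: (run s h).
Qed.

Definition acc (G : dag) : pred loc := predU (reads G) (writes G).

Fixpoint lin (G : dag) : seq action :=
  match G with
  | Leaf a => [:: a]
  | Ser G1 G2 | Par G1 G2 => lin G1 ++ lin G2
  | Scope b n G1 => Malloc b n :: rcons (lin G1) (Free b)
  end.

Lemma interleave_in T (s1 s2 s : seq T) x :
  interleave s1 s2 s -> List.In x s -> List.In x s1 \/ List.In x s2.
Proof.
elim=> [|a u t w _ IH|b u t w _ IH] //= [->|xi].
- by left; left.
- by have [] := IH xi; [left; right|right].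
- by right; left.
- by have [] := IH xi; [left|right; right].
Qed.

Lemma in_rcons T (s : seq T) y x : List.In x (rcons s y) -> List.In x s \/ x = y.
Proof.
elim: s => [|z s IH] /= [->|xi]; [by right|by []|by left; left|].
by have [] := IH xi; [left; right|right].
Qed.

Lemma sched_footprint G s a : schedule G s -> List.In a s ->
  (forall l, reads_action a l -> reads G l) /\
  (forall l, writes_action a l -> writes G l).
Proof.
move=> sc; elim: sc a => {G s} [b|G1 G2 s1 s2 _ IH1 _ IH2|
    G1 G2 s1 s2 s _ IH1 _ IH2 il|b n G s _ IH] a.
- by case=> // <-.
- move=> ai; case: (List.in_app_or _ _ _ ai) => [/IH1|/IH2] [H1 H2];
    by split=> l hl /=; rewrite ?(H1 l hl) ?(H2 l hl) ?orbT.
- move=> ai; case: (interleave_in il ai) => [/IH1|/IH2] [H1 H2];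
    by split=> l hl /=; rewrite ?(H1 l hl) ?(H2 l hl) ?orbT.
- case=> [<-|ai]; first by split=> l //= ->.
  case: (in_rcons ai) => [/IH[H1 H2]|->]; split=> l //=.
  + exact: H1.
  + by move=> hl; rewrite (H2 l hl) orbT.
  + by move=> ->.
Qed.

Lemma lin_sched G : schedule G (lin G).
Proof.
elim: G => [a|G1 IH1 G2 IH2|G1 IH1 G2 IH2|b n G IH] /=; try by constructor.
econstructor; [exact: IH1|exact: IH2|].
elim: (lin G1) => [|x s IHs] /=; last by constructor.
by elim: (lin G2) => [|x s IHs]; constructor.
Qed.

Theorem race_free_schedule (V : arith) G s (h : heap V) :
  race_free G -> schedule G s -> run s h = run (lin G) h.
Proof.
move=> rf sc; elim: sc rf h => {G s} [a|G1 G2 s1 s2 _ IH1 _ IH2|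
    G1 G2 s1 s2 s sc1 IH1 sc2 IH2 il|b n G s _ IH] //=.
- by case=> r1 r2 h; rewrite !run_cat IH1 //; case: (run _ h) => //= h'; apply: IH2.
- case=> r1 r2 ind h; rewrite (run_interleave _ il) => [|a b ai bi l].
    by rewrite !run_cat IH1 //; case: (run _ h) => //= h'; apply: IH2.
  have [ra wa] := sched_footprint sc1 ai; have [rb wb] := sched_footprint sc2 bi.
  have [n1 n2] := ind l; split.
    apply: contra n1 => /andP[/wa -> /orP[/rb ->|/wb ->]] //=; by rewrite orbT.
  by apply: contra n2 => /andP[/wb -> /ra ->].
- by move=> rf h; case: (h b) => //=; rewrite -!cats1 !run_cat IH.
Qed.

Lemma run_frame (V : arith) G (h h' : heap V) l :
  run (lin G) h = Some h' -> ~~ acc G l -> read h' l = read h l.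
Proof.
rewrite /acc /= => + /norP[_ nw].
have nws a : List.In a (lin G) -> ~~ writes_action a l.
  by move=> /(sched_footprint (lin_sched G))[_ H]; apply: contra nw; apply: H.
elim: (lin G) h nws => [|a s IH] h nws /=; first by case=> ->.
case E: (step a h) => [h1|] //= /IH ->; last by move=> b bi; apply: nws; right.
by apply: (step_frame E); apply: nws; left.
Qed.

Fixpoint leaves_keep_blocks (G : dag) : bool :=
  match G with
  | Leaf a => ~~ is_block_op a
  | Ser G1 G2 | Par G1 G2 => leaves_keep_blocks G1 && leaves_keep_blocks G2
  | Scope _ _ G1 => leaves_keep_blocks G1
  end.

(** Allocation occurs only through scopes. A scope faults unless its block was unallocated on entry,
    so the release on exit restores the original state. This is what lets size and freshness
    conditions survive a run. *)
Lemma run_extent (V : arith) G (h h' : heap V) : leaves_keep_blocks G ->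
  run (lin G) h = Some h' -> extent h' = extent h.
Proof.
elim: G h h' => [a|G1 IH1 G2 IH2|G1 IH1 G2 IH2|b n G IH] h h' /=.
- move=> na; case E: (step a h) => [h1|] //= [<-].
  have [e|wa|] := action_kind a; last by rewrite (negbTE na).
    by move: E; rewrite e => -[->].
  exact: (is_write_extent wa E).
- case/andP=> k1 k2; rewrite run_cat; case E: (run _ h) => [h1|] //= hr.
  by rewrite (IH2 _ _ k2 hr); apply: IH1.
- case/andP=> k1 k2; rewrite run_cat; case E: (run _ h) => [h1|] //= hr.
  by rewrite (IH2 _ _ k2 hr); apply: IH1.
- move=> k; case Eb: (h b) => //=; rewrite -cats1 run_cat.
  case E: (run _ _) => [h1|] //=; case Eb1: (h1 b) => [t|] //= [<-].
  have := IH _ _ k E => e; apply/funext => c; have := congr1 (fun f => f c) e.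
  by rewrite /extent /upd_block; case: eqP => // ->; rewrite Eb.
Qed.

(** * Loops *)

Lemma pow2E k : pow2 k = 2 ^ k.
Proof. by elim: k => //= k ->; rewrite expnS mul2n addnn. Qed.

Lemma pow2_gt0 k : 0 < pow2 k.
Proof. by rewrite pow2E expn_gt0. Qed.

Lemma pow2D j k : pow2 (j + k) = pow2 j * pow2 k.
Proof. by rewrite !pow2E expnD. Qed.

Lemma pow2_half k : (pow2 k + pow2 k) %/ 2 = pow2 k.
Proof. by rewrite addnn -muln2 mulnK. Qed.

Lemma acc_ser G1 G2 l : acc (Ser G1 G2) l = acc G1 l || acc G2 l.
Proof. by rewrite /acc /= orbACA. Qed.

Lemma acc_par G1 G2 l : acc (Par G1 G2) l = acc G1 l || acc G2 l.
Proof. by rewrite /acc /= orbACA. Qed.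

Lemma acc_tick l : acc (Leaf Tick) l = false.
Proof. by []. Qed.

Lemma acc_scope b n G l : acc (Scope b n G) l = (l.1 == b) || acc G l.
Proof. by rewrite /acc /= orbCA. Qed.

Definition accE := (acc_ser, acc_par, acc_tick, acc_scope, orbF, orFb).

Lemma race_free_par G1 G2 : race_free G1 -> race_free G2 ->
  (forall l, acc G1 l -> acc G2 l -> False) -> race_free (Par G1 G2).
Proof.
move=> r1 r2 d; split=> // l; have := d l; rewrite /acc /=.
by case: (reads G1 l); case: (writes G1 l); case: (reads G2 l);
  case: (writes G2 l) => //= H; have := H isT isT.
Qed.

Fixpoint simple (c : cmd) : bool :=
  match c with
  | CSkip | CZero _ | CCopy _ _ | CCompute _ _ _ _ => true
  | CSeq c1 c2 | CIfLe _ _ c1 c2 => simple c1 && simple c2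
  | _ => false
  end.

(** A [simple] command never changes a register, so its DAG is a function of the initial registers.
    Among simple commands the default case concerns [CSkip] only. *)
Fixpoint sdag (beta : nat -> block) (rho : nat -> nat) (c : cmd) : dag :=
  match c with
  | CZero d => Leaf (SetZero (addr beta rho d))
  | CCopy d x => Leaf (Copy (addr beta rho d) (addr beta rho x))
  | CCompute o d x y =>
      Leaf (Compute o (addr beta rho d) (addr beta rho x) (addr beta rho y))
  | CSeq c1 c2 => Ser (sdag beta rho c1) (sdag beta rho c2)
  | CIfLe e1 e2 c1 c2 => Ser (Leaf Tick)
      (if eval rho e1 <= eval rho e2 then sdag beta rho c1 else sdag beta rho c2)
  | _ => Leaf Tick
  end.

Fixpoint cmd_size (c : cmd) : nat :=
  match c with
  | CSeq c1 c2 => cmd_size c1 + cmd_size c2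
  | CIfLe _ _ c1 c2 => (cmd_size c1 + cmd_size c2).+1
  | _ => 1
  end.

Lemma unfolds_sdag P p beta rho c :
  simple c -> unfolds P p beta rho c rho (sdag beta rho c).
Proof.
elim: c => [|x e|d|d x|o d x y|c1 IH1 c2 IH2|e1 e2 c1 IH1 c2 IH2|
  f xs es|c1 IH1 c2 IH2|x e c IH] //=;
  try by constructor.
  by case/andP => /IH1 u1 /IH2 u2; econstructor; eauto.
by case/andP => /IH1 u1 /IH2 u2; constructor; case: ifP.
Qed.

Lemma span_le_work G : dag_span G <= dag_work G.
Proof. by elim: G => //= *; lia. Qed.

Lemma sdag_work beta rho c : dag_work (sdag beta rho c) <= cmd_size c.
Proof.
elim: c => [|x e|d|d x|o d x y|c1 IH1 c2 IH2|e1 e2 c1 IH1 c2 IH2|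
  f xs es|c1 IH1 c2 IH2|x e c IH] //=; first by lia.
by case: ifP => _; lia.
Qed.

Lemma sdag_space beta rho c : dag_space (sdag beta rho c) = 0.
Proof.
elim: c => [|x e|d|d x|o d x y|c1 IH1 c2 IH2|e1 e2 c1 IH1 c2 IH2|
  f xs es|c1 IH1 c2 IH2|x e c IH] //=.
  by rewrite IH1 IH2.
by case: ifP => _; rewrite ?IH1 ?IH2.
Qed.

Lemma sdag_race_free beta rho c : race_free (sdag beta rho c).
Proof. by elim: c => //= e1 e2 c1 e c2 e'; case: ifP. Qed.

Lemma sdag_leaves beta rho c : leaves_keep_blocks (sdag beta rho c).
Proof.
elim: c => [|x e|d|d x|o d x y|c1 IH1 c2 IH2|e1 e2 c1 IH1 c2 IH2|
  f xs es|c1 IH1 c2 IH2|x e c IH] //=.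
  by rewrite IH1 IH2.
by case: ifP => _; rewrite ?IH1 ?IH2.
Qed.

(* Iterations [EVar 0, ..., EVar 0 + EVar 1 - 1], where [EVar 1] is a power of
   two, by recursive halving. *)
Definition loop_cmd (f : nat) (body : cmd) : cmd :=
  CIfLe (EVar 1) (ECst 1) body
    (CFork
      (CCall f [:: 0; 1; 2]
         [:: EVar 0; EDiv (EVar 1) (ECst 2); EVar 2; EVar 3])
      (CCall f [:: 0; 1; 2]
         [:: EAdd (EVar 0) (EDiv (EVar 1) (ECst 2));
             EDiv (EVar 1) (ECst 2); EVar 2; EVar 3])).

Fixpoint loop_dag (bd : nat -> dag) (j lo : nat) : dag :=
  Ser (Leaf Tick)
    match j with
    | 0 => bd lo
    | j'.+1 => Ser (Leaf Tick) (Ser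
        (Par (Ser (Leaf Tick) (loop_dag bd j' lo))
             (Ser (Leaf Tick) (loop_dag bd j' (lo + pow2 j'))))
        (Leaf Tick))
    end.

Definition body_dag (bs : seq block) (a b : nat) (body : cmd) (t : nat) : dag :=
  sdag (nth null bs) (nth 0 [:: t; 1; a; b]) body.

Lemma unfolds_loop P p f body b0 b1 b2 lo j a b :
  nth CSkip P f = loop_cmd f body -> simple body ->
  unfolds P p (nth null [:: b0; b1; b2]) (nth 0 [:: lo; pow2 j; a; b])
    (loop_cmd f body) (nth 0 [:: lo; pow2 j; a; b])
    (loop_dag (body_dag [:: b0; b1; b2] a b body) j lo).
Proof.
move=> Pf sb; elim: j lo p => [|j IH] lo p; constructor => /=.
  by apply: unfolds_sdag.
have -> : pow2 j + pow2 j <= 1 = false by have := pow2_gt0 j; lia.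
by apply: unf_fork; apply: unf_call; rewrite /= pow2_half Pf; apply: IH.
Qed.

Section Loop.
Variables (bd : nat -> dag) (T : nat) (dom : nat -> pred loc).
Hypothesis bd_dom : forall t l, t < T -> acc (bd t) l -> dom t l.
Hypothesis dom_disjoint : forall t t' l,
  t < T -> t' < T -> dom t l -> dom t' l -> t = t'.

Lemma loop_acc j lo l : lo + pow2 j <= T -> acc (loop_dag bd j lo) l ->
  exists2 t, lo <= t < lo + pow2 j & dom t l.
Proof.
elim: j lo => [|j IH] lo /= le; rewrite !accE /=.
  by move/bd_dom => H; exists lo; [lia|apply: H; lia].
case/orP => /IH [|t tl dt]; try (by lia); by exists t => //; lia.
Qed.

Lemma loop_race_free j lo : (forall t, race_free (bd t)) ->
  lo + pow2 j <= T -> race_free (loop_dag bd j lo).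
Proof.
move=> rf; elim: j lo => [|j IH] lo /= le; first by split.
split=> //; split=> //; split=> //.
apply: (@race_free_par (Ser (Leaf Tick) (loop_dag bd j lo))
  (Ser (Leaf Tick) (loop_dag bd j (lo + pow2 j)))).
- by split=> //; apply: IH; lia.
- by split=> //; apply: IH; lia.
move=> l; rewrite !accE /= => /loop_acc H /loop_acc H'.
have [|t tl dt] := H; first by lia.
have [|t' tl' dt'] := H'; first by lia.
have := dom_disjoint _ _ dt dt'; lia.
Qed.

Lemma loop_leaves j lo : (forall t, leaves_keep_blocks (bd t)) ->
  leaves_keep_blocks (loop_dag bd j lo).
Proof. by move=> kb; elim: j lo => //= j IH lo; rewrite !IH. Qed.

(** An internal node costs five ticks: the test, the fork, two calls and the join. Hence the work
    increased by 5 doubles at each level. Only four of these ticks lie on one path, whence the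
    [4 * j] in [loop_span]. *)
Lemma loop_work c j lo : (forall t, dag_work (bd t) <= c) ->
  dag_work (loop_dag bd j lo) + 5 <= (c + 6) * pow2 j.
Proof.
move=> wc; elim: j lo => [|j IH] lo /=; first by have := wc lo; lia.
by have := IH lo; have := IH (lo + pow2 j); lia.
Qed.

Lemma loop_span c j lo : (forall t, dag_work (bd t) <= c) ->
  dag_span (loop_dag bd j lo) <= 4 * j + c.+1.
Proof.
move=> wc; elim: j lo => [|j IH] lo /=.
  by have := wc lo; have := span_le_work (bd lo); lia.
by have := IH lo; have := IH (lo + pow2 j); lia.
Qed.

Lemma loop_space j lo : (forall t, dag_space (bd t) = 0) ->
  dag_space (loop_dag bd j lo) = 0.
Proof. by move=> s0; elim: j lo => [|j IH] lo /=; rewrite ?s0 ?IH. Qed.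

Variables (V : arith) (Pre Post : nat -> heap V -> Prop).

(** The frame condition: [Q] depends on the heap only through the extents and the cells owned by
    iteration [t]. *)
Definition local_to t (Q : heap V -> Prop) : Prop := forall h h' : heap V,
  extent h' = extent h -> (forall l, dom t l -> read h' l = read h l) ->
  Q h -> Q h'.

Hypothesis Pre_local : forall t, t < T -> local_to t (Pre t).
Hypothesis Post_local : forall t, t < T -> local_to t (Post t).
Hypothesis bd_run : forall t h, t < T -> Pre t h ->
  exists2 h', run (lin (bd t)) h = Some h' & Post t h'.
Hypothesis bd_leaves : forall t, leaves_keep_blocks (bd t).

(** In the serial order, the preconditions of the second half survive the first half, and the
    postconditions of the first half survive the second, because the domains are disjoint. *)
Lemma loop_run j lo (h : heap V) : lo + pow2 j <= T ->
  (forall t, lo <= t < lo + pow2 j -> Pre t h) ->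
  exists2 h', run (lin (loop_dag bd j lo)) h = Some h' &
    forall t, lo <= t < lo + pow2 j -> Post t h'.
Proof.
elim: j lo h => [|j IH] lo h /= le pre.
  have [||h' hr hp] := @bd_run lo h; [lia|apply: pre; lia|].
  by exists h' => // t tl; have -> : t = lo by lia.
have [||h1 r1 p1] := IH lo h; [lia|by move=> t tl; apply: pre; lia|].
have fr1 t : lo + pow2 j <= t < lo + (pow2 j + pow2 j) ->
    forall l, dom t l -> read h1 l = read h l.
  move=> tl l dt; apply: (run_frame r1); apply/negP => /loop_acc [|t' tl' dt']; first by lia.
  have := dom_disjoint _ _ dt dt'; lia.
have [||h2 r2 p2] := IH (lo + pow2 j) h1; first by lia.
  move=> t tl; apply: (Pre_local _ (run_extent (loop_leaves _ _ bd_leaves) r1)); first by lia.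
    by apply: fr1; lia.
  by apply: pre; lia.
exists h2; first by rewrite !run_cat /= r1 /= r2.
move=> t tl; have [tlt|tge] := ltnP t (lo + pow2 j); last by apply: p2; lia.
apply: (Post_local _ (run_extent (loop_leaves _ _ bd_leaves) r2)); first by lia.
  move=> l dt; apply: (run_frame r2); apply/negP => /loop_acc [|t' tl' dt']; first by lia.
  have := dom_disjoint _ _ dt dt'; lia.
by apply: p1; lia.
Qed.

End Loop.

(** * Splitting and merging blocks *)

Lemma radix_inj a a' b b' d : b < d -> b' < d ->
  a * d + b = a' * d + b' -> a = a' /\ b = b'.
Proof.
move=> lb lb' e; have d0 : 0 < d by lia.
have := congr1 (modn^~ d) e; rewrite !modnMDl !modn_small // => eb.
have := congr1 (divn^~ d) e; rewrite !divnMDl // !divn_small // !addn0 => ea.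
by split.
Qed.

Lemma radix_lt a b m d : a < m -> b < d -> a * d + b < m * d.
Proof.
move=> la lb; apply: (@leq_trans (a * d + d)); first by lia.
by rewrite addnC -mulSn leq_mul2r la orbT.
Qed.

(* Slots 0-3, 4-7 and 8-11 are the quadrants of the left factor, of the right
   factor and of the product, which lie in row-major order in the first block;
   slots [12 + 3 * r], [13 + 3 * r] and [14 + 3 * r] are the operands and the
   result of the recursive product [r], in the second block. *)
Definition slot_op (s : nat) : operand :=
  let t := EVar 0 in let o := EVar 2 in let h := EVar 3 in
  let m := EAdd h h in let i := EDiv t h in
  let j := ESub t (EMul i h) in
  if s < 12 then
    (0, EAdd o (EAdd (EMul (ECst (s %/ 4)) (EMul m m))
      (EAdd (EMul (EAdd (EMul (ECst (s %% 4 %/ 2)) h) i) m)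
            (EAdd (EMul (ECst (s %% 2)) h) j))))
  else (1, EAdd (EMul (ECst (s - 12)) (EMul h h)) t).

(** The address denoted by [slot_op]. The language has no remainder operation, so [slot_op] obtains
    [t %% h] by a subtraction. *)
Definition slot_loc (w w' : block) (o h t s : nat) : loc :=
  if s < 12 then
    (w, o + (s %/ 4 * ((h + h) * (h + h)) +
      ((s %% 4 %/ 2 * h + t %/ h) * (h + h) + (s %% 2 * h + t %% h))))
  else (w', (s - 12) * (h * h) + t).

Lemma addr_slot w w' o h t s :
  addr (nth null [:: w; w'; w']) (nth 0 [:: t; 1; o; h]) (slot_op s) =
  slot_loc w w' o h t s.
Proof.
rewrite /slot_op /slot_loc /addr; case: ifP => _ //=.
by rewrite {2}(divn_eq t h) addKn.
Qed.

(** An offset in [w] is a mixed-radix numeral whose digits are the matrix, the quadrant row, the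
    inner row, the quadrant column and the inner column. The bounds [q2] and [q4] say that the
    digits are in range, so they can be read back. *)
Lemma slot_loc_inj w w' o h t t' s s' : w != w' -> t < h * h -> t' < h * h ->
  s < 33 -> s' < 33 -> slot_loc w w' o h t s = slot_loc w w' o h t' s' ->
  t = t' /\ s = s'.
Proof.
move=> /eqP ne lt lt' ls ls'; rewrite /slot_loc; have h0 : 0 < h by lia.
have it : t %/ h < h by rewrite ltn_divLR.
have it' : t' %/ h < h by rewrite ltn_divLR.
have jt := ltn_pmod t h0; have jt' := ltn_pmod t' h0.
have q2 x : x %% 2 * h + t %% h < h + h /\ x %% 2 * h + t' %% h < h + h.
  by have := ltn_pmod x (isT : 0 < 2); case: (x %% 2) => [|[|//]]; lia.
have q4 x : x %% 4 %/ 2 * h + t %/ h < h + h /\ x %% 4 %/ 2 * h + t' %/ h < h + h.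
  have : x %% 4 %/ 2 < 2 by rewrite ltn_divLR // ltn_mod.
  by case: (_ %/ 2) => [|[|//]]; lia.
case: ifP => hs; case: ifP => hs' // [].
- move=> /addnI e.
  have [e1 e2] := radix_inj (radix_lt (q4 s).1 (q2 s).1) (radix_lt (q4 s').2 (q2 s').2) e.
  have [e3 e4] := radix_inj (q2 s).1 (q2 s').2 e2.
  have [e5 e6] := radix_inj it it' e3; have [e7 e8] := radix_inj jt jt' e4.
  by split; [rewrite (divn_eq t h) (divn_eq t' h) e6 e8|lia].
- by move=> w1; case: ne.
- by move=> w1; case: ne.
- move=> e; have [e1 e2] := radix_inj lt lt' e.
  by split=> //; lia.
Qed.

(** Three-address code on slots: [(d, x, Some (o, y))] puts [x o y] in [d], and [(d, x, None)]
    copies [x]. It is also executed on plain functions from slots to values by [slot_exec], so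
    Strassen's formulas are checked without addresses. *)
Definition sinstr : Type := (nat * nat * option (arith_op * nat))%type.

Definition slot_cmd (i : sinstr) : cmd :=
  let: (d, x, r) := i in
  if r is Some (o, y) then CCompute o (slot_op d) (slot_op x) (slot_op y)
  else CCopy (slot_op d) (slot_op x).

Definition code_cmd (code : seq sinstr) : cmd :=
  foldr (fun i c => CSeq (slot_cmd i) c) CSkip code.

Definition slot_bounded (i : sinstr) : bool :=
  let: (d, x, r) := i in
  [&& d < 33, x < 33 & if r is Some (_, y) then y < 33 else true].

Definition slot_value (V : arith) (c : nat -> option V) x
    (r : option (arith_op * nat)) : option V :=
  if r is Some (o, y) then
    if (c x, c y) is (Some u, Some v) then Some (apply_op o u v) else None
  else c x.

Fixpoint slot_exec (V : arith) (c : nat -> option V) (code : seq sinstr) :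
    option (nat -> option V) :=
  if code is (d, x, r) :: code' then
    if slot_value c x r is Some v then
      slot_exec (fun s => if eqn s d then Some v else c s) code'
    else None
  else Some c.

Lemma code_simple code : simple (code_cmd code).
Proof. by elim: code => // -[[d x] [[o y]|]] code. Qed.

Section Slots.
Variables (w w' : block) (o k : nat).
Hypothesis ww' : w != w'.
Let h := pow2 k.
Let adr := slot_loc w w' o h.
Let bd code := body_dag [:: w; w'; w'] o h (code_cmd code).

Definition slot_dom t : pred loc := fun l => has (fun s => l == adr t s) (iota 0 33).

Lemma slot_domP t l : reflect (exists2 s, s < 33 & l = adr t s) (slot_dom t l).
Proof.
apply: (iffP hasP) => [[s]|[s ls ->]].
  by rewrite mem_iota => ls /eqP ->; exists s.
by exists s; rewrite ?mem_iota.
Qed.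

Lemma slot_acc code t l : all slot_bounded code -> acc (bd code t) l -> slot_dom t l.
Proof.
move=> + al; apply: contraTT => nd.
have ne s : s < 33 -> (l == adr t s) = false.
  by move=> ls; apply: contraNF nd => /eqP ->; apply/slot_domP; exists s.
move: al; rewrite /bd /body_dag; elim: code => [|[[d x] [[op y]|]] code IH] //=.
  rewrite acc_ser => /orP[|/IH H]; last by apply: contra H => /andP[].
  rewrite /acc /= !addr_slot => ai; apply: contraL ai => /andP[/and3P[/ne e1 /ne e2 /ne e3] _].
  by rewrite e1 e2 e3.
rewrite acc_ser => /orP[|/IH H]; last by apply: contra H => /andP[].
rewrite /acc /= !addr_slot => ai; apply: contraL ai => /andP[/and3P[/ne e1 /ne e2 _] _].
by rewrite e1 e2.
Qed.

Lemma slot_dom_disjoint t t' l : t < h * h -> t' < h * h ->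
  slot_dom t l -> slot_dom t' l -> t = t'.
Proof.
move=> lt lt' /slot_domP[s ls ->] /slot_domP[s' ls' e].
by have [] := slot_loc_inj ww' lt lt' ls ls' e.
Qed.

Lemma slot_dom_loc t l : t < h * h -> slot_dom t l ->
  (l.1 = w /\ o <= l.2 < o + 3 * ((h + h) * (h + h))) \/ l.1 = w'.
Proof.
clear ww'; move=> lt /slot_domP[s ls ->]; rewrite /adr /slot_loc.
case: ifP => hs; [left|by right].
split=> //=; rewrite leq_addr ltn_add2l /=.
have h0 : 0 < h by apply: pow2_gt0.
have it : t %/ h < h by rewrite ltn_divLR.
have jt := ltn_pmod t h0.
apply: radix_lt; first by rewrite ltn_divLR.
apply: radix_lt; last by have := ltn_pmod s (isT : 0 < 2); case: (s %% 2) => [|[|//]]; lia.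
have : s %% 4 %/ 2 < 2 by rewrite ltn_divLR // ltn_mod.
by case: (_ %/ 2) => [|[|//]]; lia.
Qed.

Section Run.
Variable V : arith.

(** There are [12 + 3 * 7 = 33] slots. The value [None] beyond them makes a column comparable with
    an abstract state by plain equality of functions. *)
Definition column (g : heap V) t s : option V :=
  if s < 33 then read g (adr t s) else None.

Definition slots_fit (g : heap V) : Prop :=
  (exists2 n, extent g w = Some n & o + 3 * ((h + h) * (h + h)) <= n) /\
  (exists2 n, extent g w' = Some n & 21 * (h * h) <= n).

Lemma slot_valid g t s : slots_fit g -> t < h * h -> s < 33 -> valid g (adr t s).
Proof.
move=> [[n en ln] [n' en' ln']] lt ls.
have : slot_dom t (adr t s) by apply/slot_domP; exists s.
move/(slot_dom_loc lt); rewrite /valid; case=> [[e b]|e].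
  by rewrite e en; lia.
move: e; rewrite /adr /slot_loc; case: ifP => hs /= e; first by move: ww'; rewrite e eqxx.
rewrite en'; apply: leq_trans ln'.
by apply: radix_lt => //; lia.
Qed.

Lemma slot_run code g t c' : all slot_bounded code -> slots_fit g -> t < h * h ->
  slot_exec (column g t) code = Some c' ->
  exists2 g', run (lin (bd code t)) g = Some g' & column g' t = c'.
Proof.
move=> + + lt; elim: code g => [|[[d x] r] code IH] g /=.
  by move=> _ _ [<-]; exists g.
move=> /andP[/and3P[ld lx lr] bc] fg.
case E: slot_value => [v|] // ex.
have [g1 w1 r1] := write_valid v (slot_valid fg lt ld).
have st : step (match r with
    | Some (op, y) => Compute op (adr t d) (adr t x) (adr t y)
    | None => Copy (adr t d) (adr t x) end) g = Some g1.
  move: E lr; rewrite /slot_value /column lx; case: r {ex} => [[op y]|] /=.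
    by move=> + ly; rewrite ly; case: read => // u; case: read => // u' [->].
  by move=> ->.
have [||g2 r2 e2] := IH g1 bc.
- have e := write_extent w1; split; rewrite /slots_fit e; apply fg.
(* Distinct slots lie in distinct cells, so one heap write changes one slot of the column, just as
   in [slot_exec]. *)
- rewrite -ex; congr slot_exec; apply/funext => s; rewrite /column r1 eqnE.
  have [->|ne] := eqVneq s d; first by rewrite ld eqxx.
  case: ifP => // ls; case: eqP => // /(slot_loc_inj ww' lt lt ls ld)[_ e].
  by rewrite e eqxx in ne.
exists g2 => //; rewrite /bd /body_dag /= -[RHS]r2.
by case: r st {E ex lr} => [[op y]|] st; rewrite run_cat /= !addr_slot -/adr;
  move: st => /= ->.
Qed.

Lemma slot_loop_run code (Pre Post : nat -> (nat -> option V) -> Prop) g :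
  all slot_bounded code ->
  (forall t c, t < h * h -> Pre t c ->
     exists2 c', slot_exec c code = Some c' & Post t c') ->
  slots_fit g -> (forall t, t < h * h -> Pre t (column g t)) ->
  exists2 g', run (lin (loop_dag (bd code) (k + k) 0)) g = Some g' &
    forall t, t < h * h -> Post t (column g' t).
Proof.
move=> bc spec fg pre.
have Ecol t g1 g2 : (forall l, slot_dom t l -> read g2 l = read g1 l) ->
    column g2 t = column g1 t.
  move=> e; apply/funext => s; rewrite /column; case: ifP => // ls.
  by apply: e; apply/slot_domP; exists s.
have [||||||||g' r p] := @loop_run (bd code) (h * h) slot_dom _ _ V
  (fun t g => slots_fit g /\ Pre t (column g t)) (fun t g => Post t (column g t))
  _ _ _ _ (k + k) 0 g.
- by move=> t l _; apply: slot_acc.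
- by move=> t t' l lt lt'; apply: slot_dom_disjoint.
- move=> t lt g1 g2 e re [[[n n1 n2] [n' n1' n2']] p]; rewrite (Ecol t g1) //.
  by split=> //; split; rewrite e; [exists n|exists n'].
- by move=> t lt g1 g2 e re p; rewrite (Ecol t g1).
- move=> t g1 lt [f1 /(spec _ _ lt)[c' ec pc]].
  by have [g2 r2 e2] := slot_run bc f1 lt ec; exists g2; rewrite ?e2.
- by move=> t; apply: sdag_leaves.
- by rewrite add0n pow2D.
- by move=> t; rewrite add0n pow2D => lt; split=> //; apply: pre; case/andP: lt.
- by exists g' => // t lt; apply: p; rewrite add0n pow2D.
Qed.

End Run.
End Slots.

(** One line per product [M1] to [M7]. Operands that are single quadrants are copied too, because a
    recursive call expects both factors and the room for the product to be contiguous. *)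
Definition split_code : seq sinstr :=
  [:: (12, 0, Some (OAdd, 3)); (13, 4, Some (OAdd, 7));
      (15, 2, Some (OAdd, 3)); (16, 4, None);
      (18, 0, None);           (19, 5, Some (OSub, 7));
      (21, 3, None);           (22, 6, Some (OSub, 4));
      (24, 0, Some (OAdd, 1)); (25, 7, None);
      (27, 2, Some (OSub, 0)); (28, 4, Some (OAdd, 5));
      (30, 1, Some (OSub, 3)); (31, 6, Some (OAdd, 7))].

(** Sums of four terms are accumulated in their destination, in the order and association of
    [strassen_rec]: an [arith] satisfies no law, so no other order would do. *)
Definition merge_code : seq sinstr :=
  [:: (8, 14, Some (OAdd, 23)); (8, 8, Some (OSub, 26)); (8, 8, Some (OAdd, 32));
      (9, 20, Some (OAdd, 26));
      (10, 17, Some (OAdd, 23));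
      (11, 14, Some (OSub, 17)); (11, 11, Some (OAdd, 20)); (11, 11, Some (OAdd, 29))].

Section Blocks.
Variable V : arith.

(** Polymorphic in [X] so that the same formulas serve for one cell, where the code computes, and
    for whole matrices, where [strassen_rec] is defined. *)
Definition lefts (X : Type) (add sub : X -> X -> X) (a11 a12 a21 a22 : X) : seq X :=
  [:: add a11 a22; add a21 a22; a11; a22; add a11 a12; sub a21 a11; sub a12 a22].

Definition rights (X : Type) (add sub : X -> X -> X) (b11 b12 b21 b22 : X) : seq X :=
  [:: add b11 b22; b11; sub b12 b22; sub b21 b11; b22; add b11 b12; add b21 b22].

Definition combine (X : Type) (add sub : X -> X -> X) (m : nat -> X) : seq X :=
  [:: add (sub (add (m 0) (m 3)) (m 4)) (m 6); add (m 2) (m 4);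
      add (m 1) (m 3); add (add (sub (m 0) (m 1)) (m 2)) (m 5)].

Definition madd n (A B : 'M[V]_n) : 'M[V]_n := map2_mx (@aadd V) A B.
Definition msub n (A B : 'M[V]_n) : 'M[V]_n := map2_mx (@asub V) A B.

Definition quads n (A : 'M[V]_(n + n)) : seq 'M[V]_n :=
  [:: ulsubmx A; ursubmx A; dlsubmx A; drsubmx A].

Definition left_factor n (A : 'M[V]_(n + n)) (r : nat) : 'M[V]_n :=
  nth (ulsubmx A) (lefts (@madd n) (@msub n)
    (ulsubmx A) (ursubmx A) (dlsubmx A) (drsubmx A)) r.

Definition right_factor n (B : 'M[V]_(n + n)) (r : nat) : 'M[V]_n :=
  nth (ulsubmx B) (rights (@madd n) (@msub n)
    (ulsubmx B) (ursubmx B) (dlsubmx B) (drsubmx B)) r.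

Definition combine_mx n (M : nat -> 'M[V]_n) : 'M[V]_(n + n) :=
  let q := nth (M 0) (combine (@madd n) (@msub n) M) in
  block_mx (q 0) (q 1) (q 2) (q 3).

Lemma strassen_recS k (A B : 'M[V]_(pow2 k.+1)) :
  strassen_rec A B =
  combine_mx (fun r => strassen_rec (left_factor A r) (right_factor B r)).
Proof. by []. Qed.

Definition holds (g : heap V) (b : block) (o n : nat) (A : 'M[V]_n) : Prop :=
  forall i j : 'I_n, read g (b, o + (i * n + j)) = Some (A i j).

Lemma split_exec (c : nat -> option V) (a : seq V) :
  (forall s, s < 8 -> c s = Some (nth (azero V) a s)) ->
  exists2 c', slot_exec c split_code = Some c' & forall r, r < 7 ->
    let x := nth (azero V) a in
    c' (12 + 3 * r) = Some (nth (azero V) (lefts (@aadd V) (@asub V)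
                                  (x 0) (x 1) (x 2) (x 3)) r) /\
    c' (13 + 3 * r) = Some (nth (azero V) (rights (@aadd V) (@asub V)
                                  (x 4) (x 5) (x 6) (x 7)) r).
Proof.
move=> E; eexists; first by rewrite /= !E //.
by do 7![case=> [//|]].
Qed.

Lemma merge_exec (c : nat -> option V) (m : nat -> V) :
  (forall r, r < 7 -> c (14 + 3 * r) = Some (m r)) ->
  exists2 c', slot_exec c merge_code = Some c' & forall q, q < 4 ->
    c' (8 + q) = Some (nth (azero V) (combine (@aadd V) (@asub V) m) q).
Proof.
move=> E; have e r : r < 7 -> c (14 + 3 * r) = Some (m r) by apply: E.
move: (e 0 isT) (e 1 isT) (e 2 isT) (e 3 isT) (e 4 isT) (e 5 isT) (e 6 isT) => /=.
rewrite !addnE !mulnE /= => e0 e1 e2 e3 e4 e5 e6.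
eexists; first by rewrite /= e0 e1 e2 e3 e4 e5 e6.
by do 4![case=> [//|]].
Qed.

Lemma left_factorE n (A : 'M[V]_(n + n)) r i j : r < 7 ->
  left_factor A r i j = nth (azero V) (lefts (@aadd V) (@asub V) (ulsubmx A i j)
    (ursubmx A i j) (dlsubmx A i j) (drsubmx A i j)) r.
Proof. by do 7![case: r => [|r]; first by rewrite /left_factor /= ?mxE]. Qed.

Lemma right_factorE n (B : 'M[V]_(n + n)) r i j : r < 7 ->
  right_factor B r i j = nth (azero V) (rights (@aadd V) (@asub V) (ulsubmx B i j)
    (ursubmx B i j) (dlsubmx B i j) (drsubmx B i j)) r.
Proof. by do 7![case: r => [|r]; first by rewrite /right_factor /= ?mxE]. Qed.

Section SplitMerge.
Variables (w w' : block) (o k : nat).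
Hypothesis ww' : w != w'.
Let h := pow2 k.
Let adr := slot_loc w w' o h.

Lemma index_div (i j : 'I_h) : (i * h + j) %/ h = i /\ (i * h + j) %% h = j.
Proof.
by rewrite divnMDl ?(leq_ltn_trans _ (ltn_ord j)) // divn_small // addn0 modnMDl modn_small.
Qed.

Lemma index_lt (i j : 'I_h) : i * h + j < h * h.
Proof. exact: radix_lt. Qed.

Lemma index_ex t : t < h * h -> exists i j : 'I_h, t = i * h + j.
Proof.
move=> lt; have h0 : 0 < h by apply: pow2_gt0.
have it : t %/ h < h by rewrite ltn_divLR.
by exists (Ordinal it), (Ordinal (ltn_pmod t h0)); rewrite /= -divn_eq.
Qed.

Lemma holds_quad (g : heap V) a (A : 'M[V]_(h + h)) (i j : 'I_h) q :
  holds g w (o + a * ((h + h) * (h + h))) A -> a < 3 -> q < 4 ->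
  read g (adr (i * h + j) (4 * a + q)) = Some (nth (ulsubmx A) (quads A) q i j).
Proof.
move=> H la lq; rewrite /adr /slot_loc.
have -> : 4 * a + q < 12 by lia.
have -> : (4 * a + q) %/ 4 = a by lia.
have -> : (4 * a + q) %% 4 = q by lia.
have -> : (4 * a + q) %% 2 = q %% 2 by lia.
have [-> ->] := index_div i j; rewrite addnA.
by case: q lq => [|[|[|[|//]]]] _; rewrite /= !mxE -H /= ?mul0n ?mul1n.
Qed.

(** Rows of a quadrant are not adjacent in row-major storage, so the converse of [holds_quad] is
    proved by locating each entry in its quadrant. *)
Lemma quad_holds (g : heap V) a (A : 'M[V]_(h + h)) : a < 3 ->
  (forall (i j : 'I_h) q, q < 4 ->
    read g (adr (i * h + j) (4 * a + q)) = Some (nth (ulsubmx A) (quads A) q i j)) ->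
  holds g w (o + a * ((h + h) * (h + h))) A.
Proof.
move=> la H I J; have step (i j : 'I_h) q (I' J' : 'I_(h + h)) :
    q < 4 -> I' = q %/ 2 * h + i :> nat -> J' = q %% 2 * h + j :> nat ->
    nth (ulsubmx A) (quads A) q i j = A I' J' ->
    read g (w, o + a * ((h + h) * (h + h)) + (I' * (h + h) + J')) = Some (A I' J').
  move=> lq e1 e2 <-; rewrite -H //; congr read; rewrite /adr /slot_loc.
  have -> : 4 * a + q < 12 by lia.
  have -> : (4 * a + q) %/ 4 = a by lia.
  have -> : (4 * a + q) %% 4 = q by lia.
  have -> : (4 * a + q) %% 2 = q %% 2 by lia.
  by have [-> ->] := index_div i j; rewrite e1 e2 -addnA.
case: (split_ordP I) => i ->; case: (split_ordP J) => j ->.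
- by apply: (step i j 0); rewrite //= !mxE.
- by apply: (step i j 1); rewrite //= ?mul1n // !mxE.
- by apply: (step i j 2); rewrite //= ?mul1n // !mxE.
- by apply: (step i j 3); rewrite //= ?mul1n // !mxE.
Qed.

Lemma column_lt (g : heap V) t s : s < 33 -> column w w' o k g t s = read g (adr t s).
Proof. by rewrite /column => ->. Qed.

Lemma split_run (g : heap V) (A B : 'M[V]_(h + h)) : slots_fit w w' o k g ->
  holds g w o A -> holds g w (o + (h + h) * (h + h)) B ->
  exists2 g', run (lin (loop_dag (body_dag [:: w; w'; w'] o h (code_cmd split_code))
      (k + k) 0)) g = Some g' &
    forall r, r < 7 -> holds g' w' (3 * r * (h * h)) (left_factor A r) /\
                       holds g' w' (3 * r * (h * h) + h * h) (right_factor B r).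
Proof.
move=> fit HA HB.
pose vals (i j : 'I_h) :=
  [:: ulsubmx A i j; ursubmx A i j; dlsubmx A i j; drsubmx A i j;
      ulsubmx B i j; ursubmx B i j; dlsubmx B i j; drsubmx B i j].
have [||||g' run' post] := @slot_loop_run w w' o k ww' V split_code
  (fun t c => forall i j : 'I_h, t = i * h + j ->
     forall s, s < 8 -> c s = Some (nth (azero V) (vals i j) s))
  (fun t c => forall i j : 'I_h, t = i * h + j -> forall r, r < 7 ->
     c (12 + 3 * r) = Some (left_factor A r i j) /\
     c (13 + 3 * r) = Some (right_factor B r i j)) g.
- by [].
- move=> t c lt pre; have [i [j e]] := index_ex lt.
  have [c' ex post] := split_exec (pre i j e); exists c' => // i' j' e' r lr.
  have [e1 e2] := radix_inj (ltn_ord j) (ltn_ord j') (etrans (esym e) e').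
  rewrite left_factorE // right_factorE // -(ord_inj e1) -(ord_inj e2).
  exact: post.
- exact: fit.
- move=> t lt i j -> s ls; rewrite column_lt; last by lia.
  have HA' : holds g w (o + 0 * ((h + h) * (h + h))) A by rewrite mul0n addn0.
  have HB' : holds g w (o + 1 * ((h + h) * (h + h))) B by rewrite mul1n.
  have [l4|l4] := ltnP s 4.
    have := holds_quad i j HA' isT l4; rewrite muln0 add0n => ->.
    by case: s l4 {ls} => [|[|[|[|//]]]].
  have ls4 : s - 4 < 4 by lia.
  have := holds_quad i j HB' isT ls4; rewrite muln1 subnKC // => -> {ls4}.
  by case: s l4 ls => [|[|[|[|[|[|[|[|]]]]]]]].
exists g' => // r lr; split=> i j.
  have [] := post _ (index_lt i j) i j erefl r lr; rewrite column_lt; last by lia.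
  move=> <- _; congr read; rewrite /adr /slot_loc.
  have -> : 12 + 3 * r < 12 = false by lia.
  by rewrite addKn.
have [] := post _ (index_lt i j) i j erefl r lr; rewrite (@column_lt _ _ (13 + _)); last by lia.
move=> _ <-; congr read; rewrite /adr /slot_loc.
have -> : 13 + 3 * r < 12 = false by lia.
have -> : 13 + 3 * r - 12 = 3 * r + 1 by lia.
by rewrite mulnDl mul1n.
Qed.

Lemma merge_run (g : heap V) (M : nat -> 'M[V]_h) : slots_fit w w' o k g ->
  (forall r, r < 7 -> holds g w' (3 * r * (h * h) + 2 * (h * h)) (M r)) ->
  exists2 g', run (lin (loop_dag (body_dag [:: w; w'; w'] o h (code_cmd merge_code))
      (k + k) 0)) g = Some g' &
    holds g' w (o + 2 * ((h + h) * (h + h))) (combine_mx M).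
Proof.
move=> fit HM.
have [||||g' run' post] := @slot_loop_run w w' o k ww' V merge_code
  (fun t c => forall i j : 'I_h, t = i * h + j ->
     forall r, r < 7 -> c (14 + 3 * r) = Some (M r i j))
  (fun t c => forall i j : 'I_h, t = i * h + j -> forall q, q < 4 ->
     c (8 + q) = Some (nth (ulsubmx (combine_mx M)) (quads (combine_mx M)) q i j)) g.
- by [].
- move=> t c lt pre; have [i [j e]] := index_ex lt.
  have [c' ex post] := merge_exec (pre i j e); exists c' => // i' j' e' q lq.
  have [e1 e2] := radix_inj (ltn_ord j) (ltn_ord j') (etrans (esym e) e').
  rewrite -(ord_inj e1) -(ord_inj e2) post //; congr Some.
  rewrite /quads /combine_mx block_mxKul block_mxKur block_mxKdl block_mxKdr.
  by case: q lq => [|[|[|[|//]]]] _ /=; rewrite !mxE.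
- exact: fit.
- move=> t lt i j -> r lr; rewrite column_lt; last by lia.
  rewrite -HM //; congr read; rewrite /adr /slot_loc.
  have -> : 14 + 3 * r < 12 = false by lia.
  have -> : 14 + 3 * r - 12 = 3 * r + 2 by lia.
  by rewrite mulnDl.
exists g' => //; apply: quad_holds => // i j q lq.
by have := post _ (index_lt i j) i j erefl q lq; rewrite column_lt //; lia.
Qed.

End SplitMerge.
End Blocks.

(** * The recursive procedure *)

Arguments code_cmd : simpl never.
Arguments body_dag : simpl never.

Definition half : expr := EDiv (EVar 1) (ECst 2).

(** The offset is that of slot [12 + 3 * i], the first of the three consecutive slots of product
    [i]. The power of seven travels in a register because expressions have no exponentiation; its
    division by 7 is exact. *)
Definition rec_call (i : nat) : cmd :=
  CCall 2 [:: 1] [:: EMul (ECst (3 * i)) (EMul half half); half;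
                     EDiv (EVar 2) (ECst 7); EVar 3].

Fixpoint rec_calls (par : bool) (n : nat) : cmd :=
  if n is n'.+1 then
    (if par then CFork else CSeq) (rec_call n') (rec_calls par n')
  else CSkip.

(* Integer registers: offset, dimension [m = 2 ^ k], [7 ^ k], space budget.  The
   factors and the product lie one after the other in block register 0.  The
   products of a level run in parallel exactly when [7 ^ k] is within budget. *)
Definition rec_cmd : cmd :=
  CIfLe (EVar 1) (ECst 1)
    (CCompute OMul (0, EAdd (EVar 0) (ECst 2)) (0, EVar 0) (0, EAdd (EVar 0) (ECst 1)))
    (CAlloc 1 (EMul (ECst 21) (EMul half half))
      (CSeq (CCall 3 [:: 0; 1; 1] [:: ECst 0; EMul half half; EVar 0; half])
      (CSeq (CIfLe (EVar 2) (EVar 3) (rec_calls true 7) (rec_calls false 7))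
            (CCall 4 [:: 0; 1; 1] [:: ECst 0; EMul half half; EVar 0; half])))).

(** The forked calls form a comb, each fork extending the path. Serial calls all run at the same
    path and so reuse the same block names, which are free again after each call. *)
Fixpoint calls_dag (par : bool) (f : nat -> seq bool -> dag) n p : dag :=
  if n is n'.+1 then
    if par then
      Ser (Leaf Tick) (Ser (Par (Ser (Leaf Tick) (f n' (true :: p)))
                                (calls_dag par f n' (false :: p))) (Leaf Tick))
    else Ser (Ser (Leaf Tick) (f n' p)) (calls_dag par f n' p)
  else Leaf Tick.

Definition slot_loop (code : seq sinstr) w w' o k : dag :=
  loop_dag (body_dag [:: w; w'; w'] o (pow2 k) (code_cmd code)) (k + k) 0.

Arguments slot_loop : simpl never.

Fixpoint rec_dag (s k : nat) (p : seq bool) (w : block) (o : nat) : dag :=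
  Ser (Leaf Tick)
    match k with
    | 0 => Leaf (Compute OMul (w, o + 2) (w, o) (w, o + 1))
    | k'.+1 =>
      let hh := pow2 k' * pow2 k' in let w' := inr p in
      Scope w' (21 * hh)
        (Ser (Ser (Leaf Tick) (slot_loop split_code w w' o k'))
        (Ser (Ser (Leaf Tick) (calls_dag (7 ^ k <= s)
               (fun i p' => rec_dag s k' p' w' (3 * i * hh)) 7 (true :: p)))
             (Ser (Leaf Tick) (slot_loop merge_code w w' o k'))))
    end.

Lemma unfolds_calls P beta rho f par :
  (forall i p, unfolds P p beta rho (rec_call i) rho (Ser (Leaf Tick) (f i p))) ->
  forall n p, unfolds P p beta rho (rec_calls par n) rho (calls_dag par f n p).
Proof.
move=> H; elim=> [|n IH] p /=; first by constructor.
by case: par IH => IH; econstructor; eauto.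
Qed.

Section UnfoldsRec.
#[local] Arguments rec_calls : simpl never.
#[local] Arguments calls_dag : simpl never.

Lemma unfolds_rec P s k p w o :
  nth CSkip P 2 = rec_cmd -> nth CSkip P 3 = loop_cmd 3 (code_cmd split_code) ->
  nth CSkip P 4 = loop_cmd 4 (code_cmd merge_code) ->
  unfolds P p (nth null [:: w]) (nth 0 [:: o; pow2 k; 7 ^ k; s]) rec_cmd
    (nth 0 [:: o; pow2 k; 7 ^ k; s]) (rec_dag s k p w o).
Proof.
move=> P2 P3 P4; elim: k p w o => [|k IH] p w o; apply: unf_if => /=.
  by apply: unf_compute.
have -> : pow2 k + pow2 k <= 1 = false by have := pow2_gt0 k; lia.
set rho := nth 0 _.
have -> : 21 * (pow2 k * pow2 k) = eval rho (EMul (ECst 21) (EMul half half)).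
  by rewrite /= pow2_half.
apply: unf_alloc; set beta := upd _ _ _.
have lp code f : nth CSkip P f = loop_cmd f (code_cmd code) ->
    forall p', unfolds P p' beta rho
      (CCall f [:: 0; 1; 1] [:: ECst 0; EMul half half; EVar 0; half]) rho
      (Ser (Leaf Tick) (slot_loop code w (inr p) o k)).
  move=> Pf p'; apply: unf_call; rewrite /= pow2_half -pow2D Pf.
  by apply: unfolds_loop => //; apply: code_simple.
apply: unf_seq; first exact: lp.
apply: unf_seq; last exact: lp.
apply: unf_if => /=.
have -> : (if 7 ^ k.+1 <= s then rec_calls true 7 else rec_calls false 7)
  = rec_calls (7 ^ k.+1 <= s) 7 by case: ifP.
apply: unfolds_calls => i p'; apply: unf_call; rewrite /= pow2_half.
have -> : rho 2 %/ 7 = 7 ^ k by rewrite /rho /= expnS mulKn.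
by rewrite P2; apply: IH.
Qed.

End UnfoldsRec.

(** Paths grow at the head, so the descendants of [p] are the paths having [p] as a suffix. The
    blocks given by the caller are below no path. *)
Definition below (p : seq bool) (b : block) : bool :=
  if b is inr q then suffix p q else false.

Lemma below_cons c p b : below (c :: p) b -> below p b.
Proof.
case: b => //= q /suffixP[r ->]; apply/suffixP; exists (rcons r c).
by rewrite cat_rcons.
Qed.

(** A path has only one suffix of a given length. *)
Lemma below_disjoint p b : below (true :: p) b -> below (false :: p) b -> False.
Proof.
case: b => //= q /suffixP[r ->] /suffixP[r' e].
have es : size r = size r' by have := congr1 size e; rewrite !size_cat /=; lia.
by move/eqP: e; rewrite eqseq_cat //= eqseq_cons /= andbF.
Qed.

Lemma below_self p : below p (inr p).
Proof. exact: suffix_refl. Qed.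

Lemma not_below_cons c p : ~~ below (c :: p) (inr p).
Proof. by apply/negP => /= /suffixP[r /(congr1 size)]; rewrite size_cat /=; lia. Qed.

(** * The seven recursive calls, forked or in series *)

Section Calls.
Variables (par : bool) (f : nat -> seq bool -> dag) (w' : block) (d : nat).

Definition chunk (i : nat) (l : loc) : Prop := l.1 = w' /\ i * d <= l.2 < i * d + d.

Lemma chunk_disjoint i i' l : i < i' -> chunk i l -> chunk i' l -> False.
Proof.
move=> lt [_ h] [_ h']; have : i.+1 * d <= i' * d by rewrite leq_mul2r lt orbT.
by rewrite mulSn; lia.
Qed.

Hypothesis f_acc : forall i p l, acc (f i p) l -> chunk i l \/ below p l.1.

Lemma calls_acc n p l : acc (calls_dag par f n p) l ->
  (exists2 i, i < n & chunk i l) \/ below p l.1.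
Proof.
elim: n p => [|n IH] p //=; case: par IH => IH; rewrite !accE.
  case/orP => [/f_acc|/IH] [H|/below_cons ?]; auto; first by left; exists n.
  by case: H => i li ?; left; exists i => //; lia.
case/orP => [/f_acc|/IH] [H|?]; auto; first by left; exists n.
by case: H => i li ?; left; exists i => //; lia.
Qed.

(** A conflict would lie in two different chunks of [w'], below two sibling paths, or in a chunk and
    below a path. The last case is excluded because [w'] is not below [p]. *)
Lemma calls_race_free n p : ~~ below p w' ->
  (forall i p', ~~ below p' w' -> race_free (f i p')) ->
  race_free (calls_dag par f n p).
Proof.
move=> + rf; elim: n p => [|n IH] p np //=.
have nc c : ~~ below (c :: p) w' by apply: contra np; apply: below_cons.
have cacc := @calls_acc n (false :: p).
case: par IH cacc => IH cacc; last by split; [split=> //; apply: rf|apply: IH].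
split=> //; split=> //.
apply: (@race_free_par (Ser (Leaf Tick) (f n (true :: p)))
  (calls_dag true f n (false :: p))); [by split=> //; apply: rf|exact: IH|].
move=> l; rewrite !accE => /f_acc H /cacc H'.
case: H' => [[i li ci]|b']; case: H => [cn|b].
- exact: chunk_disjoint li ci cn.
- by case: ci => e _; move: (nc true); rewrite -e b.
- by case: cn => e _; move: (nc false); rewrite -e b'.
- exact: below_disjoint b b'.
Qed.

Lemma calls_leaves n p : (forall i p', leaves_keep_blocks (f i p')) ->
  leaves_keep_blocks (calls_dag par f n p).
Proof. by move=> H; elim: n p => //= n IH p; case: par IH => IH /=; rewrite H IH. Qed.

Lemma calls_work n p x : (forall i p', dag_work (f i p') <= x) ->
  dag_work (calls_dag par f n p) <= n * (x + 3) + 1.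
Proof.
move=> H; elim: n p => //= n IH p.
by case: par IH => IH /=; [have := H n (true :: p); have := IH (false :: p)
                           |have := H n p; have := IH p]; lia.
Qed.

Lemma calls_span n p x : (forall i p', dag_span (f i p') <= x) ->
  dag_span (calls_dag par f n p) <= if par then x + 2 * n + 1 else n * x.+1 + 1.
Proof.
move=> H; elim: n p => [|n IH] p /=; first by case: par; lia.
by case: par IH => IH /=; [have := H n (true :: p); have := IH (false :: p)
                           |have := H n p; have := IH p]; lia.
Qed.

Lemma calls_space n p x : (forall i p', dag_space (f i p') <= x) ->
  dag_space (calls_dag par f n p) <= if par then n * x else x.
Proof.
move=> H; elim: n p => [|n IH] p /=; first by case: par.
by case: par IH => IH /=; [have := H n (true :: p); have := IH (false :: p)
                           |have := H n p; have := IH p]; lia.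
Qed.

Variables (V : arith) (In Out : nat -> heap V -> Prop).

Definition local_to_chunk i (Q : heap V -> Prop) : Prop := forall g g' : heap V,
  extent g' = extent g -> (forall l, chunk i l -> read g' l = read g l) ->
  Q g -> Q g'.

Definition fresh p (g : heap V) : Prop := forall b, below p b -> extent g b = None.

Hypothesis In_local : forall i, local_to_chunk i (In i).
Hypothesis Out_local : forall i, local_to_chunk i (Out i).
Hypothesis f_leaves : forall i p, leaves_keep_blocks (f i p).

Lemma calls_run n p g :
  (forall i p' g', i < n -> ~~ below p' w' -> fresh p' g' -> In i g' ->
    exists2 g'', run (lin (f i p')) g' = Some g'' & Out i g'') ->
  ~~ below p w' -> fresh p g -> (forall i, i < n -> In i g) ->
  exists2 g', run (lin (calls_dag par f n p)) g = Some g' & forall i, i < n -> Out i g'.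
Proof.
elim: n p g => [|n IH] p g spec np fr pre /=; first by exists g.
(* Forked and serial calls differ only in their paths once the DAG is linearised, so both are
   treated at once. *)
pose p1 := if par then true :: p else p; pose p2 := if par then false :: p else p.
have b1 b : below p1 b -> below p b by rewrite /p1; case: (par) => // /below_cons.
have b2 b : below p2 b -> below p b by rewrite /p2; case: (par) => // /below_cons.
have np1 : ~~ below p1 w' by apply: contra np; apply: b1.
have np2 : ~~ below p2 w' by apply: contra np; apply: b2.
have [||g1 r1 o1] := spec n p1 g (ltnSn n) np1; first by move=> b /b1; apply: fr.
  exact: pre.
have e1 := run_extent (f_leaves n p1) r1.
have [|||g2 r2 o2] := IH p2 g1 _ np2.
- by move=> i p' g' li; apply: spec; lia.
- by move=> b bb; rewrite e1; apply: fr; apply: b2.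
- move=> i li; apply: (In_local e1) (pre i _); last by lia.
  move=> l ci; apply: (run_frame r1); apply/negP => /f_acc[cn|b].
    exact: chunk_disjoint li ci cn.
  by case: ci => e _; move: np1; rewrite -e b.
have e2 := run_extent (calls_leaves n p2 f_leaves) r2.
exists g2.
  by move: r1 r2; rewrite /p1 /p2; case: (par) => r1 r2; rewrite !run_cat /= ?run_cat /= r1 /= r2.
move=> i; rewrite ltnS leq_eqVlt => /orP[/eqP ->|]; last exact: o2.
apply: (Out_local e2) o1 => l cn; apply: (run_frame r2); apply/negP => /calls_acc[[j lj cj]|b].
  exact: chunk_disjoint lj cj cn.
by case: cn => e _; move: np2; rewrite -e b.
Qed.

End Calls.

Arguments calls_dag : simpl never.

Lemma split_bounded : all slot_bounded split_code. Proof. by []. Qed.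
Lemma merge_bounded : all slot_bounded merge_code. Proof. by []. Qed.

Section SlotLoop.
Variables (code : seq sinstr) (w w' : block) (o k : nat).
Hypothesis bounded : all slot_bounded code.
Hypothesis ww' : w != w'.

Lemma slot_loop_acc l : acc (slot_loop code w w' o k) l ->
  (l.1 = w /\ o <= l.2 < o + 3 * (pow2 k.+1 * pow2 k.+1)) \/ l.1 = w'.
Proof.
move=> al; have [| |t lt dt] := @loop_acc _ (pow2 k * pow2 k) (slot_dom w w' o k) _ _ _ _ _ al.
- by move=> t l' _; apply: slot_acc.
- by rewrite add0n pow2D.
have lt' : t < pow2 k * pow2 k by rewrite -pow2D; case/andP: lt.
exact: (slot_dom_loc lt' dt).
Qed.

Lemma slot_loop_race_free : race_free (slot_loop code w w' o k).
Proof.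
apply: (@loop_race_free _ (pow2 k * pow2 k) (slot_dom w w' o k)).
- by move=> t l' _; apply: slot_acc.
- by move=> t t' l lt lt'; apply: slot_dom_disjoint.
- by move=> t; apply: sdag_race_free.
- by rewrite add0n pow2D.
Qed.

Lemma slot_loop_leaves : leaves_keep_blocks (slot_loop code w w' o k).
Proof. by apply: loop_leaves => t; apply: sdag_leaves. Qed.

Lemma slot_loop_work :
  dag_work (slot_loop code w w' o k) <= (cmd_size (code_cmd code) + 6) * (pow2 k * pow2 k).
Proof.
rewrite -pow2D; apply: leq_trans (loop_work _ 0 _); first exact: leq_addr.
by move=> t; apply: sdag_work.
Qed.

Lemma slot_loop_span :
  dag_span (slot_loop code w w' o k) <= 8 * k + (cmd_size (code_cmd code)).+1.
Proof.
clear bounded ww'.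
by apply: leq_trans (loop_span (k + k) 0 (fun t => sdag_work _ _ _)) _; lia.
Qed.

Lemma slot_loop_space : dag_space (slot_loop code w w' o k) = 0.
Proof. by apply: loop_space => t; apply: sdag_space. Qed.

End SlotLoop.

(** * Footprint, cost and correctness of the recursion *)

Section Recursion.
Variable s : nat.

Lemma rec_dagS k p w o : rec_dag s k.+1 p w o =
  let hh := pow2 k * pow2 k in
  Ser (Leaf Tick) (Scope (inr p) (21 * hh)
    (Ser (Ser (Leaf Tick) (slot_loop split_code w (inr p) o k))
    (Ser (Ser (Leaf Tick) (calls_dag (7 ^ k.+1 <= s)
           (fun i p' => rec_dag s k p' (inr p) (3 * i * hh)) 7 (true :: p)))
         (Ser (Leaf Tick) (slot_loop merge_code w (inr p) o k))))).
Proof. by []. Qed.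

Lemma rec_acc k p w o l : acc (rec_dag s k p w o) l ->
  (l.1 = w /\ o <= l.2 < o + 3 * (pow2 k * pow2 k)) \/ below p l.1.
Proof.
elim: k p w o l => [|k IH] p w o l.
  rewrite /= !accE /acc /= => H; left; move: l H => [b x] /=.
  by rewrite !xpair_eqE => /orP[/orP[]|] /andP[/eqP -> /eqP ->] /=; split=> //; lia.
have self b : b = inr p -> below p b by move=> ->; apply: below_self.
rewrite rec_dagS !accE => /orP[/eqP e|/orP[al|/orP[al|al]]].
- by right; apply: self.
- by case: (slot_loop_acc split_bounded al) => [?|e]; [left|right; apply: self].
- have [|[i li [e _]]|b] := @calls_acc _ _ (inr p) (3 * (pow2 k * pow2 k)) _ _ _ _ al.
  + move=> i p' l' /IH[[e b]|]; [left|by right].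
    by split=> //; move: b; rewrite -mulnA mulnCA.
  + by right; apply: self.
  + by right; apply: below_cons b.
- by case: (slot_loop_acc merge_bounded al) => [?|e]; [left|right; apply: self].
Qed.

Lemma rec_chunk k p i p' l :
  acc (rec_dag s k p' (inr p) (3 * i * (pow2 k * pow2 k))) l ->
  chunk (inr p) (3 * (pow2 k * pow2 k)) i l \/ below p' l.1.
Proof.
case/rec_acc => [[e b]|]; [left|by right].
by split=> //; move: b; rewrite -mulnA mulnCA.
Qed.

Lemma rec_leaves k p w o : leaves_keep_blocks (rec_dag s k p w o).
Proof.
elim: k p w o => [|k IH] p w o //; rewrite rec_dagS /=.
rewrite !slot_loop_leaves andbT /=.
by apply: calls_leaves => i p'; apply: IH.
Qed.

Lemma outside_neq p w : ~~ below p w -> w != inr p.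
Proof. by apply: contraNneq => ->; apply: below_self. Qed.

Lemma rec_race_free k p w o : ~~ below p w -> race_free (rec_dag s k p w o).
Proof.
elim: k p w o => [|k IH] p w o np; first by [].
rewrite rec_dagS /=.
have lp code := @slot_loop_race_free code w (inr p) o k.
split=> //; split; first by split=> //; apply: lp => //; apply: outside_neq.
split; last by split=> //; apply: lp => //; apply: outside_neq.
split=> //; apply: (@calls_race_free _ _ (inr p) (3 * (pow2 k * pow2 k))).
- by move=> i p' l; apply: rec_chunk.
- exact: not_below_cons.
- by move=> i p'; apply: IH.
Qed.

(** A level on quadrants of [hh] cells adds at most [21 * hh + 15 * hh] for its loops and 28 for
    control, hence at most [64 * hh]. The potential pays [(7 - 4) * 24 * hh = 72 * hh]. The constant
    26 is 24 plus the work 2 of the base case. *)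
Lemma rec_work k p w o :
  dag_work (rec_dag s k p w o) + 24 * (pow2 k * pow2 k) <= 26 * 7 ^ k.
Proof.
elim: k p w o => [|k IH] p w o //; rewrite rec_dagS /=.
have hh0 : 0 < pow2 k * pow2 k by rewrite muln_gt0 pow2_gt0.
have := slot_loop_work split_code w (inr p) o k.
have := slot_loop_work merge_code w (inr p) o k.
have IH' i p' : dag_work (rec_dag s k p' (inr p) (3 * i * (pow2 k * pow2 k))) <=
    26 * 7 ^ k - 24 * (pow2 k * pow2 k).
  by have := IH p' (inr p) (3 * i * (pow2 k * pow2 k)); lia.
have := calls_work (7 ^ k.+1 <= s) 7 (true :: p) IH'.
have := IH p w o.
have -> : (pow2 k + pow2 k) * (pow2 k + pow2 k) = 4 * (pow2 k * pow2 k) by ring.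
rewrite -[cmd_size (code_cmd split_code)]/15 -[cmd_size (code_cmd merge_code)]/9.
by have := expnS 7 k; lia.
Qed.

(** The potential solves the recurrence [S(k+1) = 7 * S(k) + 21 * 4 ^ k], as [21 = (7 - 4) * 7]. *)
Lemma rec_space_par k p w o : 7 ^ k <= s ->
  dag_space (rec_dag s k p w o) + 7 * (pow2 k * pow2 k) <= 7 * 7 ^ k.
Proof.
elim: k p w o => [|k IH] p w o // le; rewrite rec_dagS /= !slot_loop_space.
have le' : 7 ^ k <= s by apply: leq_trans le; rewrite leq_exp2l.
have IH' i p' : dag_space (rec_dag s k p' (inr p) (3 * i * (pow2 k * pow2 k))) <=
    7 * 7 ^ k - 7 * (pow2 k * pow2 k).
  by have := IH p' (inr p) (3 * i * (pow2 k * pow2 k)) le'; lia.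
have := calls_space (7 ^ k.+1 <= s) 7 (true :: p) IH'.
have := IH p w o le'.
have -> : (pow2 k + pow2 k) * (pow2 k + pow2 k) = 4 * (pow2 k * pow2 k) by ring.
by rewrite le; move: le; rewrite expnS; lia.
Qed.

(** The parallel part contributes at most [7 * 7 ^ k <= 7 * s]. Each serial level adds [21 * hh],
    exactly the growth of [7 * hh] when [hh] is multiplied by 4. *)
Lemma rec_space k p w o :
  dag_space (rec_dag s k p w o) <= 7 * s + 7 * (pow2 k * pow2 k).
Proof.
elim: k p w o => [|k IH] p w o //; have [le|gt] := leqP (7 ^ k.+1) s.
  by have := rec_space_par p w o le; lia.
rewrite rec_dagS /= !slot_loop_space.
have IH' i p' := IH p' (inr p) (3 * i * (pow2 k * pow2 k)).
have := calls_space (7 ^ k.+1 <= s) 7 (true :: p) IH'.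
have -> : (pow2 k + pow2 k) * (pow2 k + pow2 k) = 4 * (pow2 k * pow2 k) by ring.
have -> : 7 ^ k.+1 <= s = false by rewrite leqNgt gt.
by lia.
Qed.

(** A level adds at most [16 * k + 47] to the path, which the difference [48 * (2 * k + 3)] of
    consecutive bounds exceeds. *)
Lemma rec_span_par k p w o : 7 ^ k <= s ->
  dag_span (rec_dag s k p w o) <= 48 * k.+1 ^ 2.
Proof.
elim: k p w o => [|k IH] p w o // le; rewrite rec_dagS /=.
have le' : 7 ^ k <= s by apply: leq_trans le; rewrite leq_exp2l.
have IH' i p' := IH p' (inr p) (3 * i * (pow2 k * pow2 k)) le'.
have := calls_span (7 ^ k.+1 <= s) 7 (true :: p) IH'; rewrite le.
have := slot_loop_span split_code w (inr p) o k.
have := slot_loop_span merge_code w (inr p) o k.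
rewrite -[cmd_size (code_cmd split_code)]/15 -[cmd_size (code_cmd merge_code)]/9.
have -> : k.+2 ^ 2 = k.+1 ^ 2 + 2 * k + 3 by rewrite -[k.+2]addn1 -[k.+1]addn1; ring.
by lia.
Qed.

(** A fixed [L] above all levels replaces the loop cost of each serial level by the same [40 * L],
    so the logarithmic factor does not change during the induction. *)
Lemma rec_span k p w o L : k < L ->
  s * dag_span (rec_dag s k p w o) <= 416 * L ^ 2 * (s + 7 ^ k).
Proof.
have [le lt|gt] := leqP (7 ^ k) s.
  have h1 := rec_span_par p w o le.
  have h2 : k.+1 ^ 2 <= L ^ 2 by rewrite leq_exp2r.
  have h3 : dag_span (rec_dag s k p w o) <= 416 * L ^ 2 by lia.
  by rewrite mulnDr mulnC; apply: leq_trans (leq_addr _ _); rewrite leq_mul2r h3 orbT.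
(* The added [40 * L] is a potential: the recurrence [x -> 7 * x + 40 * L] becomes multiplication of
   [x + 40 * L] by at most 7. *)
suff H : s < 7 ^ k -> k < L ->
    s * (dag_span (rec_dag s k p w o) + 40 * L) <= 416 * L ^ 2 * 7 ^ k.
  move=> lt; apply: leq_trans (leq_trans (H gt lt) _); first by rewrite leq_mul2l leq_addr orbT.
  by rewrite leq_mul2l leq_addl orbT.
elim: k p w o {gt} => [|k IH] p w o gt lt.
  by move: gt; rewrite expn0 ltnS leqn0 => /eqP ->.
have L0 : L <= L ^ 2 by case: (L) => // n; rewrite -{1}[n.+1]expn1 leq_pexp2l.
have step x : (forall i p', dag_span (rec_dag s k p' (inr p) (3 * i * (pow2 k * pow2 k))) <= x) ->
    dag_span (rec_dag s k.+1 p w o) <= 7 * x + 40 * L.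
  move=> hx; have := calls_span (7 ^ k.+1 <= s) 7 (true :: p) hx.
  rewrite rec_dagS /=.
  have -> : 7 ^ k.+1 <= s = false by rewrite leqNgt gt.
  have := slot_loop_span split_code w (inr p) o k.
  have := slot_loop_span merge_code w (inr p) o k.
  rewrite -[cmd_size (code_cmd split_code)]/15 -[cmd_size (code_cmd merge_code)]/9.
  by lia.
have [le|gt'] := leqP (7 ^ k) s.
  have h2 : k.+1 ^ 2 <= L ^ 2 by rewrite leq_exp2r // ltnW.
  have := step (48 * k.+1 ^ 2) (fun i p' => rec_span_par p' (inr p) _ le) => h1.
  (* The lowest serial level makes seven parallel computations in sequence:
     [416 = 7 * 48 + 2 * 40]. *)
  have h3 : dag_span (rec_dag s k.+1 p w o) + 40 * L <= 416 * L ^ 2 by lia.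
  by rewrite mulnC; apply: leq_mul => //; apply: ltnW.
have [s0|s0] := posnP s; first by rewrite s0 mul0n.
(* The largest natural number allowed by the induction hypothesis, which thus becomes one bound
   valid for all seven calls. *)
pose y := 416 * L ^ 2 * 7 ^ k %/ s.
have := step (y - 40 * L) _ => h1.
have hy i p' : dag_span (rec_dag s k p' (inr p) (3 * i * (pow2 k * pow2 k))) + 40 * L <= y.
  by rewrite leq_divRL // mulnC; apply: IH => //; apply: ltnW.
have h2 : dag_span (rec_dag s k.+1 p w o) <= 7 * (y - 40 * L) + 40 * L.
  by apply: h1 => i p'; have := hy i p'; lia.
have h3 : 40 * L <= y by have := hy 0 p; lia.
have h4 : s * y <= 416 * L ^ 2 * 7 ^ k by rewrite mulnC leq_divM.
apply: (@leq_trans (s * (7 * y))); first by rewrite leq_mul2l; apply/orP; right; lia.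
by rewrite (expnS 7 k) mulnCA (mulnCA _ 7) leq_mul2l h4.
Qed.

Section Correct.
Variable V : arith.

Definition room (g : heap V) w x : Prop := exists2 n, extent g w = Some n & x <= n.

Lemma holds_local (g g' : heap V) b o n (A : 'M[V]_n) :
  (forall i j : 'I_n, read g' (b, o + (i * n + j)) = read g (b, o + (i * n + j))) ->
  holds g b o A -> holds g' b o A.
Proof. by move=> e H i j; rewrite e. Qed.

Lemma rec_run k p w o (A B : 'M[V]_(pow2 k)) g :
  ~~ below p w -> fresh p g -> room g w (o + 3 * (pow2 k * pow2 k)) ->
  holds g w o A -> holds g w (o + pow2 k * pow2 k) B ->
  exists2 g', run (lin (rec_dag s k p w o)) g = Some g' &
    holds g' w (o + 2 * (pow2 k * pow2 k)) (strassen_rec A B).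
Proof.
elim: k p w o A B g => [|k IH] p w o A B g np fr [N eN lN] HA HB.
  have ra : read g (w, o) = Some (A ord0 ord0).
    by have := HA ord0 ord0; rewrite /= mul0n !addn0.
  have rb : read g (w, o + 1) = Some (B ord0 ord0).
    by have := HB ord0 ord0; rewrite /= mul0n muln1 !addn0.
  have vz : valid g (w, o + 2) by rewrite /valid /= eN; move: lN => /=; lia.
  have [g' wr rd] := write_valid (amul (A ord0 ord0) (B ord0 ord0)) vz.
  exists g'; first by rewrite /= ra rb /= wr.
  by move=> i j; rewrite !ord1 /= mul0n rd !addn0 eqxx mxE.
set h := pow2 k; set hh := h * h.
have hh0 : 0 < hh by rewrite muln_gt0 pow2_gt0.
have wn := outside_neq np.
have gp : g (inr p) = None.
  have := fr (inr p) (below_self p); rewrite /extent; by case: (g _).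
pose g1 := upd_block g (inr p) (Some (nseq (21 * hh) None)).
have rd1 l : l.1 = w -> read g1 l = read g l by move=> e; apply: read_upd_other; rewrite e.
have e1 b : extent g1 b = if b == inr p then Some (21 * hh) else extent g b.
  by rewrite /extent /g1 /upd_block; case: ifP => //= _; rewrite size_nseq.
have fit g' : extent g' = extent g1 -> slots_fit w (inr p) o k g'.
  move=> e; split; rewrite e e1.
    by rewrite (negbTE wn); exists N.
  by rewrite eqxx; exists (21 * hh).
have [|||g2 r2 p2] := @split_run V w (inr p) o k wn g1 A B.
- exact: fit.
- by apply: holds_local HA => i j; apply: rd1.
- by apply: holds_local HB => i j; apply: rd1.
have e2 := run_extent (slot_loop_leaves split_code w (inr p) o k) r2.
pose f i p' := rec_dag s k p' (inr p) (3 * i * hh).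
pose In i (g' : heap V) := [/\ room g' (inr p) (3 * i * hh + 3 * hh),
  holds g' (inr p) (3 * i * hh) (left_factor A i) &
  holds g' (inr p) (3 * i * hh + hh) (right_factor B i)].
pose Out i (g' : heap V) := holds g' (inr p) (3 * i * hh + 2 * hh)
  (strassen_rec (left_factor A i) (right_factor B i)).
have inchunk i c (a b : 'I_h) : c < 3 ->
    chunk (inr p) (3 * hh) i (inr p, 3 * i * hh + c * hh + (a * h + b)).
  move=> lc; split=> //=; have := index_lt a b; rewrite -/h -/hh.
  by case: c lc => [|[|[|//]]] _; lia.
have [||||||||g3 r3 p3] := @calls_run (7 ^ k.+1 <= s) f (inr p) (3 * hh) _ V In Out _ _ _
    7 (true :: p) g2.
- by move=> i p' l; apply: rec_chunk.
- move=> i g' g'' e rd [rm HL HR]; split; first by move: rm; rewrite /room e.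
    by apply: holds_local HL => a b; apply: rd; have := inchunk i 0 a b isT; rewrite addn0.
  by apply: holds_local HR => a b; apply: rd; have := inchunk i 1 a b isT; rewrite mul1n.
- move=> i g' g'' e rd HO.
  by apply: holds_local HO => a b; apply: rd; apply: inchunk.
- by move=> i p'; apply: rec_leaves.
- by move=> i p' g' li np' fr' [rm HL HR]; apply: IH.
- exact: not_below_cons.
(* The calls run at path [true :: p] whereas the new block is named [p], so it does not spoil their
   freshness condition. *)
- move=> b bb; rewrite e2 e1; case: eqP => [e|_]; last by apply: fr; apply: below_cons bb.
  by move: (not_below_cons true p); rewrite -e bb.
- move=> i li; have [HL HR] := p2 i li; split=> //.
  rewrite /room e2 e1 eqxx; exists (21 * hh) => //.
  by rewrite -mulnDl leq_mul2r; apply/orP; right; lia.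
have lf3 : leaves_keep_blocks (calls_dag (7 ^ k.+1 <= s) f 7 (true :: p)).
  by apply: calls_leaves => i p'; apply: rec_leaves.
have e3 := run_extent lf3 r3.
have [||g4 r4 p4] := @merge_run V w (inr p) o k wn g3
    (fun r => strassen_rec (left_factor A r) (right_factor B r)).
- by apply: fit; rewrite e3.
- by move=> r lr; apply: p3.
have e4 := run_extent (slot_loop_leaves merge_code w (inr p) o k) r4.
exists (upd_block g4 (inr p) None).
  rewrite rec_dagS /= -cats1 gp /= !run_cat /= -/h -/hh -/g1 r2 /= !run_cat r3 /= r4 /=.
  have : extent g4 (inr p) = Some (21 * hh) by rewrite e4 e3 e2 e1 eqxx.
  by rewrite /extent; case: (g4 _).
rewrite strassen_recS; apply: holds_local p4 => i j.
by apply: read_upd_other.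
Qed.

End Correct.
End Recursion.

(** * The main procedure *)

Definition row_expr : expr := EDiv (EVar 0) (EVar 3).
Definition col_expr : expr := ESub (EVar 0) (EMul row_expr (EVar 3)).
Definition sq_expr : expr := EMul (EVar 3) (EVar 3).
Definition cell_expr : expr := EAdd (EMul row_expr (EVar 2)) col_expr.

Definition if_inside (c1 c2 : cmd) : cmd :=
  CIfLe (EAdd row_expr (ECst 1)) (EVar 2)
    (CIfLe (EAdd col_expr (ECst 1)) (EVar 2) c1 c2) c2.

Definition in_body : cmd :=
  if_inside (CSeq (CCopy (2, EVar 0) (0, cell_expr))
                  (CCopy (2, EAdd sq_expr (EVar 0)) (1, cell_expr)))
            (CSeq (CZero (2, EVar 0)) (CZero (2, EAdd sq_expr (EVar 0)))).

Definition out_body : cmd :=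
  if_inside (CCopy (0, cell_expr) (2, EAdd (EMul (ECst 2) sq_expr) (EVar 0))) CSkip.

Definition solve_cmd : cmd :=
  let args := [:: ECst 0; EMul (EVar 2) (EVar 2); EVar 0; EVar 2] in
  CAlloc 3 (EMul (ECst 3) (EMul (EVar 2) (EVar 2)))
    (CSeq (CCall 5 [:: 0; 1; 3] args)
    (CSeq (CCall 2 [:: 3] [:: ECst 0; EVar 2; EVar 3; EVar 1])
          (CCall 6 [:: 2; 2; 3] args))).

(* Integer registers: [n], [s], [2 ^ k], [7 ^ k]. *)
Definition grow_cmd : cmd :=
  CIfLe (EVar 0) (EVar 2) solve_cmd
    (CCall 1 [:: 0; 1; 2]
       [:: EVar 0; EVar 1; EAdd (EVar 2) (EVar 2); EMul (ECst 7) (EVar 3)]).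

(* The unused block of [s] cells makes the space at least [s]. *)
Definition main_cmd : cmd :=
  CSeq (CAlloc 3 (EVar 1) CSkip)
       (CCall 1 [:: 0; 1; 2] [:: EVar 0; EVar 1; ECst 1; ECst 1]).

Definition strassen_program : program :=
  [:: main_cmd; grow_cmd; rec_cmd; loop_cmd 3 (code_cmd split_code);
      loop_cmd 4 (code_cmd merge_code); loop_cmd 5 in_body; loop_cmd 6 out_body].

Section Main.
Variables (n s : nat).
Let k := up_log 2 n.
Let N := pow2 k.
Let W : block := inr [::].

Definition in_loop : dag :=
  loop_dag (body_dag [:: inA; inB; W] n N in_body) (k + k) 0.
Definition out_loop : dag :=
  loop_dag (body_dag [:: outC; outC; W] n N out_body) (k + k) 0.

Definition solve_dag : dag :=
  Scope W (3 * (N * N))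
    (Ser (Ser (Leaf Tick) in_loop)
    (Ser (Ser (Leaf Tick) (rec_dag s k [:: true] W 0))
         (Ser (Leaf Tick) out_loop))).

Fixpoint grow_dag (d : nat) : dag :=
  Ser (Leaf Tick) (if d is d'.+1 then Ser (Leaf Tick) (grow_dag d') else solve_dag).

(** Both scopes are opened at the empty path and are therefore named [W]; the idle one is closed
    before the working block is allocated, so the space is a maximum and not a sum. *)
Definition main_dag : dag :=
  Ser (Scope W s (Leaf Tick)) (Ser (Leaf Tick) (grow_dag k)).

Lemma le_nN : n <= N.
Proof. by rewrite /N pow2E up_logP. Qed.

Lemma unfolds_solve :
  unfolds strassen_program [::] (nth null [:: inA; inB; outC])
    (nth 0 [:: n; s; N; 7 ^ k]) solve_cmd (nth 0 [:: n; s; N; 7 ^ k]) solve_dag.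
Proof.
apply: unf_alloc; apply: unf_seq; last apply: unf_seq.
- apply: unf_call; rewrite /= -/N -pow2D.
  exact: (@unfolds_loop strassen_program _ 5).
- apply: unf_call; exact: unfolds_rec.
- apply: unf_call; rewrite /= -/N -pow2D.
  exact: (@unfolds_loop strassen_program _ 6).
Qed.

Lemma unfolds_grow d k0 : k0 + d = k ->
  unfolds strassen_program [::] (nth null [:: inA; inB; outC])
    (nth 0 [:: n; s; pow2 k0; 7 ^ k0]) grow_cmd (nth 0 [:: n; s; pow2 k0; 7 ^ k0])
    (grow_dag d).
Proof.
elim: d k0 => [|d IH] k0 e; apply: unf_if => /=.
  have ek : k0 = k by rewrite -e addn0.
  by rewrite ek le_nN; apply: unfolds_solve.
have -> : n <= pow2 k0 = false.
  (* The doubling stops exactly at [k], by minimality of [up_log]. *)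
  apply/negbTE/negP => le; have := @up_log_min 2 n k0 isT.
  by rewrite -pow2E -/k => /(_ le); lia.
by apply: unf_call; rewrite /= -expnS; apply: (IH k0.+1); lia.
Qed.

Lemma main_computation : computation strassen_program [:: n; s] main_dag.
Proof.
eexists; apply: unf_seq.
  by apply: unf_alloc; apply: unf_skip.
apply: unf_call; exact: (@unfolds_grow k 0).
Qed.

(** One domain serves both conversion loops: besides three cells of [W], iteration [t] owns the
    matching entry in every other block, provided that it lies inside the unpadded matrix. *)
Definition conv_dom t : pred loc := fun l =>
  if l.1 == W then l.2 \in [:: t; N * N + t; 2 * (N * N) + t]
  else [&& t %/ N < n, t %% N < n & l.2 == t %/ N * n + t %% N].

Lemma conv_dom_disjoint t t' l : t < N * N -> t' < N * N ->
  conv_dom t l -> conv_dom t' l -> t = t'.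
Proof.
move=> lt lt'; rewrite /conv_dom; case: ifP => _.
  by rewrite !inE => /or3P[]/eqP-> /or3P[]/eqP; lia.
move=> /and3P[i j /eqP ->] /and3P[i' j' /eqP e].
have [e1 e2] := radix_inj j j' e.
by rewrite (divn_eq t N) (divn_eq t' N) e1 e2.
Qed.

Definition inside (G1 G2 : dag) t : dag :=
  Ser (Leaf Tick) (if t %/ N < n then Ser (Leaf Tick) (if t %% N < n then G1 else G2)
                   else G2).

Lemma sub_div t d : t - t %/ d * d = t %% d.
Proof. by rewrite {1}(divn_eq t d) addKn. Qed.

Lemma in_bodyE t : body_dag [:: inA; inB; W] n N in_body t =
  inside (Ser (Leaf (Copy (W, t) (inA, t %/ N * n + t %% N)))
              (Leaf (Copy (W, N * N + t) (inB, t %/ N * n + t %% N))))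
         (Ser (Leaf (SetZero (W, t))) (Leaf (SetZero (W, N * N + t)))) t.
Proof. by rewrite /body_dag /inside /= /addr /= sub_div !addn1. Qed.

Lemma out_bodyE t : body_dag [:: outC; outC; W] n N out_body t =
  inside (Leaf (Copy (outC, t %/ N * n + t %% N) (W, 2 * (N * N) + t))) (Leaf Tick) t.
Proof. by rewrite /body_dag /inside /= /addr /= sub_div !addn1. Qed.

Lemma in_body_acc t l : acc (body_dag [:: inA; inB; W] n N in_body t) l -> conv_dom t l.
Proof.
rewrite in_bodyE /inside accE; case: ifP => ti; rewrite ?accE; last first.
  by rewrite /acc /= => /orP[] /eqP ->; rewrite /conv_dom eqxx !inE eqxx ?orbT.
case: ifP => tj; last first.
  by rewrite accE /acc /= => /orP[] /eqP ->; rewrite /conv_dom eqxx !inE eqxx ?orbT.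
rewrite accE /acc /= => /orP[] /orP[] /eqP ->;
  by rewrite /conv_dom /= ?eqxx ?ti ?tj ?inE ?eqxx ?orbT.
Qed.

Lemma out_body_acc t l : acc (body_dag [:: outC; outC; W] n N out_body t) l -> conv_dom t l.
Proof.
rewrite out_bodyE /inside accE; case: ifP => ti; rewrite ?accE //.
case: ifP => tj //.
rewrite /acc /= => /orP[] /eqP ->;
  by rewrite /conv_dom /= ?eqxx ?ti ?tj ?inE ?eqxx ?orbT.
Qed.

Lemma NN : pow2 (k + k) = N * N. Proof. exact: pow2D. Qed.

Lemma conv_race_free bs body :
  (forall t l, acc (body_dag bs n N body t) l -> conv_dom t l) ->
  race_free (loop_dag (body_dag bs n N body) (k + k) 0).
Proof.
move=> H; apply: (@loop_race_free _ (N * N) conv_dom).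
- by move=> t l _; apply: H.
- by move=> t t' l; apply: conv_dom_disjoint.
- by move=> t; apply: sdag_race_free.
- by rewrite NN.
Qed.

Lemma main_race_free : race_free main_dag.
Proof.
split=> //; split=> //.
have Hs : race_free solve_dag.
  split; first by split=> //; apply: conv_race_free; apply: in_body_acc.
  split; last by split=> //; apply: conv_race_free; apply: out_body_acc.
  by split=> //; apply: rec_race_free.
by elim: (k) => [|d IH] /=; split.
Qed.

Lemma solve_leaves : leaves_keep_blocks solve_dag.
Proof.
rewrite /solve_dag /= rec_leaves /= /in_loop /out_loop.
by rewrite !loop_leaves // => t; apply: sdag_leaves.
Qed.

Lemma main_work : dag_work main_dag <= 80 * 7 ^ k.
Proof.
have bw bs body t : dag_work (body_dag bs n N body t) <= cmd_size body by apply: sdag_work.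
have w1 := loop_work (k + k) 0 (bw [:: inA; inB; W] in_body).
have w2 := loop_work (k + k) 0 (bw [:: outC; outC; W] out_body).
have w3 := rec_work s k [:: true] W 0.
rewrite -[cmd_size _]/8 -/in_loop NN in w1; rewrite -[cmd_size _]/5 -/out_loop NN in w2.
have e : N * N <= 7 ^ k.
  by rewrite /N; elim: (k) => //= j IH; rewrite expnS; lia.
have k7 : k < 7 ^ k by apply: ltn_expl.
have g d : dag_work (grow_dag d) = 1 + 2 * d + dag_work solve_dag.
  by elim: d => [|d IH] //; rewrite [LHS]/= IH; lia.
rewrite /= g /=; lia.
Qed.

Lemma main_span L : k < L -> s * dag_span main_dag <= 500 * L ^ 2 * (s + 7 ^ k).
Proof.
move=> lt.
have bw bs body t : dag_work (body_dag bs n N body t) <= cmd_size body by apply: sdag_work.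
have w1 := loop_span (k + k) 0 (bw [:: inA; inB; W] in_body).
have w2 := loop_span (k + k) 0 (bw [:: outC; outC; W] out_body).
have w3 := rec_span s [:: true] W 0 lt.
rewrite -[cmd_size _]/8 -/in_loop in w1; rewrite -[cmd_size _]/5 -/out_loop in w2.
have g d : dag_span (grow_dag d) = 1 + 2 * d + dag_span solve_dag.
  by elim: d => [|d IH] //; rewrite [LHS]/= IH; lia.
have L0 : L <= L ^ 2 by case: (L) lt => // m _; rewrite -{1}[m.+1]expn1 leq_pexp2l.
have e : dag_span main_dag <= dag_span (rec_dag s k [:: true] W 0) + 84 * L ^ 2.
  by rewrite /= g /=; lia.
apply: leq_trans (leq_mul (leqnn s) e) _; rewrite mulnDr.
apply: leq_trans (leq_add w3 (leqnn _)) _.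
rewrite -[500]/(416 + 84) 2!mulnDl leq_add2l mulnC leq_mul2l leq_addr orbT //.
Qed.

Lemma main_space_ge : s <= dag_space main_dag.
Proof. by rewrite /= addn0 leq_max leqnn. Qed.

Lemma main_space_le : dag_space main_dag <= 7 * s + 10 * (N * N).
Proof.
have g d : dag_space (grow_dag d) = dag_space solve_dag.
  by elim: d => [|d IH]; [exact: max0n|rewrite [LHS]/= IH !max0n].
have := rec_space s k [:: true] W 0; rewrite -/N /= g /= /in_loop /out_loop.
rewrite !loop_space; last 2 first.
- by move=> t; apply: sdag_space.
- by move=> t; apply: sdag_space.
lia.
Qed.

Section Correct.
Variable V : arith.

(** The entries of [resize_mx] on natural indices, which avoids casts between ordinals of different
    bounds. *)
Definition pad m (A : 'M[V]_m) (i j : nat) : V :=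
  match insub i : option 'I_m, insub j : option 'I_m with
  | Some i', Some j' => A i' j'
  | _, _ => azero V
  end.

Lemma resize_pad m m' (A : 'M[V]_m) (i j : 'I_m') : resize_mx m' A i j = pad A i j.
Proof. by rewrite mxE. Qed.

Lemma pad_in m (A : 'M[V]_m) (i j : 'I_m) : pad A i j = A i j.
Proof. by rewrite /pad !valK. Qed.

Lemma pad_out m (A : 'M[V]_m) i j : ~~ ((i < m) && (j < m)) -> pad A i j = azero V.
Proof.
rewrite /pad; case: insubP => // i' li _; case: insubP => // j' lj _.
by rewrite li lj.
Qed.

Lemma in_run (A B : 'M[V]_n) g : room g W (3 * (N * N)) ->
  holds g inA 0 A -> holds g inB 0 B ->
  exists2 g', run (lin in_loop) g = Some g' &
    holds g' W 0 (resize_mx N A) /\ holds g' W (N * N) (resize_mx N B).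
Proof.
move=> rm HA HB.
pose Pre t (g : heap V) := room g W (3 * (N * N)) /\
  forall i j : 'I_n, t %/ N = i -> t %% N = j ->
    read g (inA, i * n + j) = Some (A i j) /\ read g (inB, i * n + j) = Some (B i j).
pose Post t (g : heap V) := read g (W, t) = Some (pad A (t %/ N) (t %% N)) /\
  read g (W, N * N + t) = Some (pad B (t %/ N) (t %% N)).
have [||||||||g' r p] := @loop_run (body_dag [:: inA; inB; W] n N in_body) (N * N)
  conv_dom _ _ V Pre Post _ _ _ _ (k + k) 0 g.
- by move=> t l _; apply: in_body_acc.
- by move=> t t' l; apply: conv_dom_disjoint.
- move=> t lt g1 g2 e re [rm1 H]; split; first by rewrite /room e.
  move=> i j ei ej; rewrite !re; first exact: H.
    by rewrite /conv_dom /= ei ej !ltn_ord eqxx.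
  by rewrite /conv_dom /= ei ej !ltn_ord eqxx.
- move=> t lt g1 g2 e re [H1 H2]; rewrite /Post !re //.
    by rewrite /conv_dom /= !inE eqxx orbT.
  by rewrite /conv_dom /= !inE eqxx.
- move=> t g1 lt [[M eM lM] H].
  have v1 (g0 : heap V) : extent g0 = extent g1 -> valid g0 (W, t).
    by move=> e; rewrite /valid e /= eM; lia.
  have v2 (g0 : heap V) : extent g0 = extent g1 -> valid g0 (W, N * N + t).
    by move=> e; rewrite /valid e /= eM; lia.
  have ne : ((W, t) == (W, N * N + t)) = false.
    by apply/negbTE/eqP => -[]; lia.
  have fin a b x : run (lin x) g1 = obind (fun g => write g (W, N * N + t) b) (write g1 (W, t) a) ->
      a = pad A (t %/ N) (t %% N) -> b = pad B (t %/ N) (t %% N) ->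
      exists2 h', run (lin x) g1 = Some h' & Post t h'.
    move=> ex ea eb; have [g2 w2 r2] := write_valid a (v1 g1 erefl).
    have [g3 w3 r3] := write_valid b (v2 g2 (write_extent w2)).
    exists g3; first by rewrite ex w2 /= w3.
    by rewrite /Post !r3 r2 eqxx ne eqxx ea eb.
  rewrite in_bodyE; have [/andP[li lj]|out] := boolP ((t %/ N < n) && (t %% N < n)).
    have [ra rb] := H (Ordinal li) (Ordinal lj) erefl erefl; rewrite /= in ra rb.
    apply: (fin (A (Ordinal li) (Ordinal lj)) (B (Ordinal li) (Ordinal lj))).
    - rewrite /inside /= li lj /= ra /=.
      case E: (write _ _ _) => [g2|] //=; rewrite (write_read E) /= rb.
      by case: (write _ _ _).
    - by rewrite -pad_in.
    - by rewrite -pad_in.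
  apply: (fin (azero V) (azero V)); try by rewrite pad_out.
  rewrite /inside /=; move: out; case: (t %/ N < n) => /= [/negbTE ->|_] /=;
    by case: (write _ _ _) => //= g2; case: (write _ _ _).
- by move=> t; apply: sdag_leaves.
- by rewrite NN.
- move=> t lt; split=> // i j _ _; split.
    by have := HA i j; rewrite add0n.
  by have := HB i j; rewrite add0n.
exists g' => //.
have idx (i j : 'I_N) := index_div i j.
split=> i j; have [] := p (i * N + j); rewrite ?NN ?index_lt //;
  by have [-> ->] := idx i j; rewrite resize_pad.
Qed.

Lemma out_run (M : 'M[V]_N) g : room g outC (n * n) -> holds g W (2 * (N * N)) M ->
  exists2 g', run (lin out_loop) g = Some g' & holds g' outC 0 (resize_mx n M).
Proof.
move=> rm HM.
pose Pre t (g : heap V) := room g outC (n * n) /\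
  read g (W, 2 * (N * N) + t) = Some (pad M (t %/ N) (t %% N)).
pose Post t (g : heap V) := forall i j : 'I_n, t %/ N = i -> t %% N = j ->
  read g (outC, i * n + j) = Some (pad M i j).
have [||||||||g' r p] := @loop_run (body_dag [:: outC; outC; W] n N out_body) (N * N)
  conv_dom _ _ V Pre Post _ _ _ _ (k + k) 0 g.
- by move=> t l _; apply: out_body_acc.
- by move=> t t' l; apply: conv_dom_disjoint.
- move=> t lt g1 g2 e re [rm1 H]; split; first by rewrite /room e.
  by rewrite re //= /conv_dom /= !inE eqxx !orbT.
- move=> t lt g1 g2 e re H i j ei ej; rewrite re ?H //.
  by rewrite /conv_dom /= ei ej !ltn_ord eqxx.
- move=> t g1 lt [[m em lm] H]; rewrite out_bodyE /inside.
  have [/andP[li lj]|out] := boolP ((t %/ N < n) && (t %% N < n)).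
    have v : valid g1 (outC, t %/ N * n + t %% N).
      by rewrite /valid /= em; apply: leq_trans lm; apply: radix_lt.
    have [g2 w2 r2] := write_valid (pad M (t %/ N) (t %% N)) v.
    exists g2; first by rewrite /= li lj /= H /= w2.
    by move=> i j ei ej; rewrite r2 ei ej eqxx.
  exists g1; first by move: out => /=; case: (t %/ N < n) => //= /negbTE ->.
  by move=> i j ei ej; move: out; rewrite ei ej !ltn_ord.
- by move=> t; apply: sdag_leaves.
- by rewrite NN.
- move=> t; rewrite NN => /andP[_ lt]; split=> //.
  have [i [j ->]] := index_ex lt; rewrite HM; have [-> ->] := index_div i j.
  by rewrite pad_in.
exists g' => // i j; rewrite add0n resize_pad.
have lN := le_nN; have li := leq_trans (ltn_ord i) lN; have lj := leq_trans (ltn_ord j) lN.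
apply: (p (i * N + j)); first by rewrite NN; apply: radix_lt.
  by rewrite divnMDl ?(leq_ltn_trans _ lj) // divn_small // addn0.
by rewrite modnMDl modn_small.
Qed.

Lemma stores_holds m (g : heap V) b (A : 'M[V]_m) :
  stores g b A <-> extent g b = Some (m * m) /\ holds g b 0 A.
Proof.
split=> [[t [gt st H]]|[]].
  by split=> [|i j]; [rewrite /extent gt /= st|rewrite /read /= gt H].
rewrite /extent; case E: (g b) => [t|] //= [st] H; exists t; split=> // i j.
by have := H i j; rewrite /read /= E.
Qed.

Lemma main_computes (A B : 'M[V]_n) : computes main_dag A B (strassen A B).
Proof.
move=> h [/stores_holds[eA HA] /stores_holds[eB HB] [tC hC sC] h0] sg sched.
rewrite (race_free_schedule h main_race_free sched).
have hW : h W = None by apply: h0.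
(* The heap after the idle block has been allocated and freed; it is the initial one. *)
pose h1 := upd_block (upd_block h W (Some (nseq s None))) W None.
have e1 : h1 = h.
  by apply/funext => b; rewrite /h1 /upd_block; case: eqP => // ->.
suff [g r H] : exists2 g, run (lin solve_dag) h = Some g & holds g outC 0 (strassen A B).
  exists g.
    rewrite /= hW /= -/h1 e1.
    by elim: (k) => [|d IH].
  apply/stores_holds; split=> //; rewrite (run_extent solve_leaves r).
  by rewrite /extent hC /= sC.
pose g1 := upd_block h W (Some (nseq (3 * (N * N)) None)).
have rd1 l : l.1 != W -> read g1 l = read h l by apply: read_upd_other.
have E1 b : extent g1 b = if b == W then Some (3 * (N * N)) else extent h b.
  by rewrite /extent /g1 /upd_block; case: ifP => //= _; rewrite size_nseq.
have rmW : room g1 W (3 * (N * N)) by rewrite /room E1 eqxx; exists (3 * (N * N)).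
have [||g2 r2 [HA2 HB2]] := in_run rmW (A := A) (B := B).
- by apply: holds_local HA => i j; apply: rd1.
- by apply: holds_local HB => i j; apply: rd1.
have kl bs body : leaves_keep_blocks (loop_dag (body_dag bs n N body) (k + k) 0).
  by apply: loop_leaves => t; apply: sdag_leaves.
have e2 := run_extent (kl _ _) r2.
have [|||||g3 r3 H3] := @rec_run s V k [:: true] W 0 (resize_mx N A) (resize_mx N B) g2.
- by [].
- move=> b bb; rewrite e2 E1; case: eqP => [e|_]; first by move: bb; rewrite e.
  rewrite /extent h0 //; apply/negP; rewrite !inE => /or3P[] /eqP e;
    by move: bb; rewrite e.
- by rewrite /room e2.
- exact: HA2.
- exact: HB2.
have e3 := run_extent (rec_leaves _ _ _ _ _) r3.
have [||g4 r4 H4] := @out_run (strassen_rec (resize_mx N A) (resize_mx N B)) g3.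
- by rewrite /room e3 e2 E1 /=; exists (n * n) => //; rewrite /extent hC /= sC.
- exact: H3.
have e4 := run_extent (kl _ _) r4.
exists (upd_block g4 W None); last first.
  by apply: holds_local H4 => i j; apply: read_upd_other.
rewrite /= hW /= -cats1 !run_cat /= -/g1 r2 /= !run_cat r3 /= r4 /=.
have : extent g4 W = Some (3 * (N * N)) by rewrite e4 e3 e2 E1 eqxx.
by rewrite /extent; case: (g4 W).
Qed.

End Correct.
End Main.

(** * Strassen's identities *)

Local Open Scope ring_scope.

Lemma strassen_block_mul (K : pzRingType) n (A11 A12 A21 A22 B11 B12 B21 B22 : 'M[K]_n) :
  let M1 := (A11 + A22) *m (B11 + B22) in
  let M2 := (A21 + A22) *m B11 in
  let M3 := A11 *m (B12 - B22) in
  let M4 := A22 *m (B21 - B11) in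
  let M5 := (A11 + A12) *m B22 in
  let M6 := (A21 - A11) *m (B11 + B12) in
  let M7 := (A12 - A22) *m (B21 + B22) in
  block_mx (M1 + M4 - M5 + M7) (M3 + M5) (M2 + M4) (M1 - M2 + M3 + M6) =
  block_mx A11 A12 A21 A22 *m block_mx B11 B12 B21 B22.
Proof.
rewrite /= mulmx_block !(mulmxDl, mulmxDr, mulmxBl, mulmxBr, mulNmx, mulmxN).
(* Each block is now a flat sum of products. The permutations below bring opposite terms together
   and use commutativity of addition only. *)
congr block_mx; rewrite !(opprD, opprK, addrA).
- rewrite [LHS](ACl (1*9*(2*7)*(3*6)*(4*12)*(5*11)*(10*8)))%AC /=.
  by rewrite !(subrr, addr0).
- by rewrite addrNK.
- by rewrite [LHS](ACl (1*3*(2*4)))%AC /= subrr addr0.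
- rewrite [LHS](ACl (10*4*(1*11)*(2*8)*(3*6)*(9*5)*(7*12)))%AC /=.
  by rewrite !(subrr, addr0).
Qed.

Lemma strassen_rec_mul (K : pzRingType) k (A B : 'M[K]_(pow2 k)) :
  @strassen_rec (ring_arith K) k A B = A *m B.
Proof.
have addE n (X Y : 'M[K]_n) : map2_mx (@aadd (ring_arith K)) X Y = X + Y.
  by apply/matrixP => i j; rewrite !mxE.
have subE n (X Y : 'M[K]_n) : map2_mx (@asub (ring_arith K)) X Y = X - Y.
  by apply/matrixP => i j; rewrite !mxE.
elim: k A B => [|k IH] A B.
  by apply/matrixP => i j; rewrite /= !mxE big_ord1 !ord1.
rewrite /= !addE !subE !IH strassen_block_mul; congr mulmx; exact: submxK.
Qed.

(** In the padded product, the terms whose inner index is at least [n] vanish because the padded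
    left factor is zero there. *)
Lemma strassen_mul (K : pzRingType) n (A B : 'M[K]_n) :
  @strassen (ring_arith K) n A B = A *m B.
Proof.
have le := le_nN n; set N := pow2 (up_log 2 n) in le.
pose pd m (X : 'M[K]_m) : nat -> nat -> K := @pad (ring_arith K) m X.
have padE m m' (X : 'M[K]_m) (a b : 'I_m') :
  @resize_mx (ring_arith K) m m' X a b = pd m X a b by apply: resize_pad.
have pdE m (X : 'M[K]_m) (a b : 'I_m) : pd m X a b = X a b.
  exact: (@pad_in (ring_arith K)).
rewrite /strassen strassen_rec_mul; apply/matrixP => i j; rewrite padE.
rewrite (pdE _ _ (widen_ord le i) (widen_ord le j)) !mxE.
under eq_bigr => l _ do rewrite !padE.
under [RHS]eq_bigr => l _ do rewrite -!pdE.
rewrite (big_ord_widen N (fun l => pd n A i l * pd n B l j) le) [RHS]big_mkcond /=.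
apply: eq_bigr => l _; case: ifP => // nl.
have -> : pd n A i l = 0 by apply: (@pad_out (ring_arith K)); rewrite nl andbF.
by rewrite mul0r.
Qed.

(** * From powers of two to real exponents and logarithms *)

Section Bounds.
Variable R : realType.

Lemma powR_pow2_omega j : (2 ^ j)%:R `^ omega R = (7 ^ j)%:R :> R.
Proof.
have ln2 : 0 < ln 2 :> R by rewrite ln_gt0 // ltr1n.
rewrite /powR; have -> : ((2 ^ j)%:R == 0 :> R) = false by rewrite pnatr_eq0 expn_eq0.
rewrite natrX lnXn ?ltr0n // /omega /log2.
have l7 : ln 7 *+ j = ln (7 ^+ j) :> R by rewrite lnXn ?ltr0n.
have -> : ln 7 / ln 2 * (ln 2 *+ j) = ln 7 *+ j :> R.
  by rewrite mulrnAr divfK // gt_eqF.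
by rewrite l7 lnK ?natrX // posrE exprn_gt0.
Qed.

(** For [k = up_log 2 n] and [n > 1], minimality gives [2 ^ (k - 1) < n], hence
    [7 ^ (k - 1) <= n ^ omega]; padding costs one factor 7. *)
Lemma up_log_pow n : (0 < n)%N -> (7 ^ up_log 2 n)%:R <= 7 * n%:R `^ omega R :> R.
Proof.
move=> n0; have [n1|] := ltnP 1 n; last first.
  move=> n1; have -> : n = 1%N by lia.
  by rewrite up_log1 expn0 powR1 mulr1 ler1n.
have /andP[lt _] := up_log_bounds (isT : 1 < 2)%N n1.
have : (0 < up_log 2 n)%N by rewrite up_log_gt0.
case: (up_log 2 n) lt => //= k lt _.
rewrite expnS natrM ler_pM2l ?ltr0n // -powR_pow2_omega.
apply: ge0_ler_powR; rewrite ?nnegrE ?ler_nat //; last exact: ltnW.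
by rewrite /omega /log2 divr_ge0 // ln_ge0 // ler1n.
Qed.

(** The left side is [(k - 1) + 2] with [k - 1 <= log2 n], and [2 <= 2 * log2 n] because [n] is at
    least 2. *)
Lemma up_log_log2 n : (1 < n)%N -> (up_log 2 n).+1%:R <= 3 * log2 n%:R :> R.
Proof.
move=> n1; have ln2 : 0 < ln 2 :> R by rewrite ln_gt0 // ltr1n.
have /andP[lt _] := up_log_bounds (isT : 1 < 2)%N n1.
have : (0 < up_log 2 n)%N by rewrite up_log_gt0.
case: (up_log 2 n) lt => //= k lt _.
have h1 : 1 <= log2 n%:R :> R.
  by rewrite /log2 ler_pdivlMr // mul1r ler_ln ?posrE ?ltr0n ?ler_nat //; lia.
have h2 : k%:R <= log2 n%:R :> R.
  rewrite /log2 ler_pdivlMr // mulr_natl -lnXn // ler_ln ?posrE ?exprn_gt0 ?ltr0n //; last by lia.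
  by rewrite -natrX ler_nat ltnW.
by rewrite -addn2 natrD; lra.
Qed.

Lemma up_log_sq n : (0 < n)%N -> (pow2 (up_log 2 n) * pow2 (up_log 2 n) <= 4 * n ^ 2)%N.
Proof.
move=> n0; have [n1|] := ltnP 1 n; last first.
  by move=> n1; have -> : n = 1%N by lia; rewrite up_log1.
have /andP[lt _] := up_log_bounds (isT : 1 < 2)%N n1.
have : (0 < up_log 2 n)%N by rewrite up_log_gt0.
by rewrite !pow2E; case: (up_log 2 n) lt => //= k lt _; rewrite expnS; nia.
Qed.

End Bounds.

(** The program computes on naturals, so its budget is [s] truncated. The span is bounded for
    [1 < n] because [log2 1 = 0] whereas a span is positive. *)
Theorem theorem3 (R : realType) :
  exists (P : program) (c C : R), 0 < c /\
  forall (n : nat) (s : R), (0 < n)%N ->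
    n%:R ^+ 2 <= s <= n%:R `^ omega R ->
  exists G : dag,
    [/\ computation P [:: n; Num.truncn s] G,
        race_free G,
        c * s <= (dag_space G)%:R <= C * s,
        (dag_work G)%:R <= C * n%:R `^ omega R
      & (1 < n)%N ->
        (dag_span G)%:R <= C * (n%:R `^ omega R / s) * log2 n%:R ^+ 2] /\
    (forall (V : arith) (A B : 'M[V]_n), computes G A B (strassen A B)) /\
    (forall (K : pzRingType) (A B : 'M[K]_n),
        @computes (ring_arith K) n G A B (A *m B)).
Proof.
(* The constant stays a product because natural-number literals are unary. *)
exists strassen_program, 2^-1, (9 * (8 * 1000)); split; first by rewrite invr_gt0.
move=> n s n0 /andP[sge sle]; pose s' := Num.truncn s; pose k := up_log 2 n.
set q := n%:R `^ omega R in sle *.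
have s0 : 0 <= s by apply: le_trans sge; rewrite exprn_ge0.
have /andP[s'le s'gt] : s'%:R <= s < s'.+1%:R by apply: truncn_itv.
have n2s' : (n ^ 2 <= s')%N by rewrite /s' truncn_ge_nat // natrX.
have s'1 : (0 < s')%N by apply: leq_trans n2s'; rewrite expn_gt0 n0.
have s'1R : 1 <= s'%:R :> R by rewrite ler1n.
(* Truncation loses less than 1, and [s'] is at least 1; this is the origin of the lower constant
   [2^-1]. *)
have s2 : s <= 2 * s'%:R by move: s'gt; rewrite -natr1; lra.
have spos : 0 < s by lra.
have qk : (7 ^ k)%:R <= 7 * q by apply: up_log_pow.
exists (main_dag n s'); split; last first.
  split=> [V|K] A B; first exact: main_computes.
  by rewrite -strassen_mul; apply: main_computes.
split.
- exact: main_computation.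
- exact: main_race_free.
- have := main_space_ge n s'; have := main_space_le n s'.
  (* The padded area is at most [4 * n ^ 2 <= 4 * s'], and [47 = 7 + 10 * 4]. *)
  rewrite -!(ler_nat R); have : (7 * s' + 10 * (pow2 k * pow2 k) <= 47 * s')%N.
    by have := up_log_sq n0; rewrite -/k; lia.
  by rewrite -(ler_nat R) !natrM; lra.
- have := main_work n s'; rewrite -(ler_nat R) natrM; lra.
- move=> n1; have hL := up_log_log2 R n1.
  have := main_span s' (ltnSn k); rewrite -(ler_nat R).
  rewrite (natrM _ s') (natrM _ (500 * _)%N) (natrM _ 500) natrX natrD.
  set D := (dag_span _)%:R; set L := k.+1%:R => hD.
  have L0 : 0 <= L by [].
  have D0 : 0 <= D by [].
  have L2 : L ^+ 2 <= 9 * log2 n%:R ^+ 2.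
    have -> : 9 * log2 n%:R ^+ 2 = (3 * log2 n%:R) ^+ 2 :> R by ring.
    by rewrite ler_pXn2r // nnegrE (le_trans _ hL).
  (* This uses [s' <= s <= q] and [7 ^ k <= 7 * q]. The span constant collects 2 from truncation,
     500 from [main_span], 9 from the squared logarithm and this 8. *)
  have sq : s'%:R + (7 ^ k)%:R <= 8 * q by lra.
  have q0 : 0 <= q by lra.
  rewrite mulrA mulrAC ler_pdivlMr // mulrAC.
  have h1 : s * D <= 2 * (s'%:R * D) by rewrite mulrA ler_wpM2r.
  have h2 : 500 * L ^+ 2 * (s'%:R + (7 ^ k)%:R) <= 500 * (9 * log2 n%:R ^+ 2) * (8 * q).
    apply: ler_pM => //; [by rewrite mulr_ge0 ?exprn_ge0|by rewrite addr_ge0|].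
    by rewrite ler_pM2l.
  by lra.
Qed.
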